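(* Let $k$ be a field of characteristic $p>0$, $F$ an extension field of $k$, and $H$ a height-one group scheme over $k$ with restricted Lie algebra $\mathfrak{h}=\mathrm{Lie}(H)$, acting faithfully on $\mathrm{Spec}(F)$, i.e. we are given an injective $k$-linear homomorphism of restricted Lie algebras $\mathfrak{h}\subset\mathrm{Der}_k(F)$. Let $E=F^{\mathfrak{h}}$, $Z=\mathrm{Spec}(F)$ viewed as an $E$-scheme, $Z_F=\mathrm{Spec}(F\otimes_EF)$, $H_F=H\otimes_kF$, $\mathfrak{h}_F=\mathfrak{h}\otimes_kF$, and let $z_0\in Z_F$ be its unique rational point. Let $H_F^{\mathrm{inert}}\subset H_F$ be the inertia subgroup scheme of $z_0$, with Lie algebra $\mathfrak{h}_F^{\mathrm{inert}}\subset\mathfrak{h}_F$. Then: 1. The orbit morphism $H_F\to Z_F$, $h\mapsto h\cdot z_0$, induces an identification $H_F/H_F^{\mathrm{inert}}=\mathrm{Spec}(F\otimes_EF)$. 2. The inertia Lie algebra $\mathfrak{h}_F^{\mathrm{inert}}$ is the kernel of the canonical surjection $\mathfrak{h}\otimes_kF\to\mathfrak{h}\cdot F=\mathrm{Der}_E(F)$. 3. $[F:E]=p^c$, where $c\geq 0$ is the codimension of $\mathfrak{h}_F^{\mathrm{inert}}$ in $\mathfrak{h}_F$.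
   Context: A height-one group scheme over $k$ is a group scheme of finite type annihilated by the relative Frobenius. By the Demazure–Gabriel correspondence, $G\mapsto\mathrm{Lie}(G)$ is an equivalence from height-one group schemes to finite-dimensional restricted Lie algebras, and homomorphisms of restricted Lie algebras $\mathfrak{h}\to\mathrm{Der}_k(F)$ correspond to actions of $H$ on $\mathrm{Spec}(F)$. $F^{\mathfrak{h}}=\bigcap_{D\in\mathfrak{h}}\mathrm{Ker}(D:F\to F)$, so that $\mathfrak{h}\subset\mathrm{Der}_E(F)$ and $H_E=H\otimes_kE$ acts on the $E$-scheme $Z$; by base-change $H_F$ acts on $Z_F$. $\mathfrak{h}\cdot F\subset\mathrm{Der}_E(F)$ is the $F$-vector subspace generated by $\mathfrak{h}$. The ring $F\otimes_EF$ is an $F$-algebra via $\lambda\mapsto1\otimes\lambda$; it is a local Artin ring with residue field $F$, and the point $z_0$ is given by the multiplication map $\lambda\otimes\mu\mapsto\lambda\mu$. The inertia subgroup scheme is the stabilizer of $z_0$ in $H_F$. *)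

(* Defs.v *)
From HB Require Import structures.
From mathcomp Require Import mpoly.
From mathcomp Require Import all_boot all_algebra.
From mathcomp Require Import boolp functions.

Set Implicit Arguments.
Unset Strict Implicit.
Unset Printing Implicit Defensive.

Import GRing.Theory.
Local Open Scope ring_scope.
Local Open Scope quotient_scope.

(* A commutative K-algebra is a commutative ring with a structure map from K. *)
Record algebra (K : comPzRingType) := Algebra {
  alg_ring :> comPzRingType;
  alg_map : {rmorphism K -> alg_ring} }.

Record alg_hom (K : comPzRingType) (B C : algebra K) := AlgHom {
  hom_map :> {rmorphism B -> C};
  hom_alg : forall a, hom_map (alg_map B a) = alg_map C a }.

Definition base (K : comPzRingType) : algebra K := Algebra idfun.

Definition restr (K L : comPzRingType) (i : {rmorphism K -> L})
  (C : algebra L) : algebra K := Algebra (alg_map C \o i).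

Section AlgHoms.
Variable K : comPzRingType.

Lemma id_alg_subproof (B : algebra K) (a : K) :
  (idfun : {rmorphism B -> B}) (alg_map B a) = alg_map B a.
Proof. by []. Qed.
Definition hom_id (B : algebra K) : alg_hom B B :=
  AlgHom (@id_alg_subproof B).

Lemma comp_alg_subproof (B C D : algebra K) (u : alg_hom C D)
  (g : alg_hom B C) (a : K) :
  (hom_map u \o hom_map g) (alg_map B a) = alg_map D a.
Proof. by rewrite /= !hom_alg. Qed.
Definition hom_comp (B C D : algebra K) (u : alg_hom C D) (g : alg_hom B C) :
  alg_hom B D := AlgHom (comp_alg_subproof u g).

Lemma str_alg_subproof (C : algebra K) (a : K) :
  alg_map C (alg_map (base K) a) = alg_map C a.
Proof. by []. Qed.
Definition hom_str (C : algebra K) : alg_hom (base K) C :=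
  AlgHom (@str_alg_subproof C).
End AlgHoms.

Lemma restr_alg_subproof (K L : comPzRingType) (i : {rmorphism K -> L})
  (C D : algebra L) (u : alg_hom C D) (a : K) :
  hom_map u (alg_map (restr i C) a) = alg_map (restr i D) a.
Proof. by rewrite /= hom_alg. Qed.
Definition hom_restr (K L : comPzRingType) (i : {rmorphism K -> L})
  (C D : algebra L) (u : alg_hom C D) : alg_hom (restr i C) (restr i D) :=
  @AlgHom _ (restr i C) (restr i D) (hom_map u) (restr_alg_subproof i u).

(* An algebra viewed as a module over its base. *)
Definition asmod (K : comPzRingType) (B : algebra K) : Type := B.
Section AsMod.
Variables (K : comPzRingType) (B : algebra K).
HB.instance Definition _ := GRing.ComPzRing.on (asmod B).
Definition asmod_scale (a : K) (b : asmod B) : asmod B :=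
  (alg_map B a : asmod B) * b.
Fact asmod_scaleA a b v :
  asmod_scale a (asmod_scale b v) = asmod_scale (a * b) v.
Proof. by rewrite /asmod_scale mulrA rmorphM. Qed.
Fact asmod_scale1 : left_id 1 asmod_scale.
Proof. by move=> v; rewrite /asmod_scale rmorph1 mul1r. Qed.
Fact asmod_scaleDr : right_distributive asmod_scale +%R.
Proof. by move=> a u v; rewrite /asmod_scale mulrDr. Qed.
Fact asmod_scaleDl v : {morph asmod_scale^~ v : a b / a + b}.
Proof. by move=> a b; rewrite /asmod_scale rmorphD mulrDl. Qed.
HB.instance Definition _ := GRing.Zmodule_isLmodule.Build K (asmod B)
  asmod_scaleA asmod_scale1 asmod_scaleDr asmod_scaleDl.
End AsMod.

Section Tensor.
Variables (K : comPzRingType) (M N : lmodType K).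

Definition balanced (P : zmodType) (b : M -> N -> P) : Prop :=
  [/\ forall m m' n, b (m + m') n = b m n + b m' n,
      forall m n n', b m (n + n') = b m n + b m n' &
      forall a m n, b (a *: m) n = b m (a *: n)].

Definition tsum (P : zmodType) (b : M -> N -> P) (s : seq (M * N)) : P :=
  \sum_(x <- s) b x.1 x.2.

(* A list of pairs stands for the sum of the corresponding pure tensors. Two
   such sums are equal in the tensor product exactly when no balanced map
   separates them. *)
Definition tens_rel (s t : seq (M * N)) : bool :=
  `[< forall (P : zmodType) (b : M -> N -> P),
        balanced b -> tsum b s = tsum b t >].

Fact tens_rel_refl : reflexive tens_rel.
Proof. by move=> s; apply/asboolP. Qed.
Fact tens_rel_sym : symmetric tens_rel.
Proof.
by move=> s t; apply/asboolP/asboolP => h P b bb; rewrite h.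
Qed.
Fact tens_rel_trans : transitive tens_rel.
Proof.
by move=> s t u /asboolP h /asboolP h'; apply/asboolP => P b bb; rewrite h // h'.
Qed.
Canonical tens_equiv :=
  EquivRel tens_rel tens_rel_refl tens_rel_sym tens_rel_trans.

Definition tens : Type := {eq_quot tens_rel}.
HB.instance Definition _ := Choice.on tens.
HB.instance Definition _ := EqQuotient.on tens.

Definition pure (m : M) (n : N) : tens := \pi_tens [:: (m, n)].
Definition tlift (P : zmodType) (b : M -> N -> P) (t : tens) : P :=
  tsum b (repr t).

Lemma tlift_pi (P : zmodType) (b : M -> N -> P) s :
  balanced b -> tlift b (\pi_tens s) = tsum b s.
Proof.
move=> bb; rewrite /tlift; case: piP => t /eqmodP /asboolP h.
by rewrite -(h _ _ bb).
Qed.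

Lemma tens_pi_eq s t :
  (forall (P : zmodType) (b : M -> N -> P),
     balanced b -> tsum b s = tsum b t) -> \pi_tens s = \pi_tens t.
Proof. by move=> h; apply/eqmodP/asboolP. Qed.

Lemma tens_ext (t u : tens) :
  (forall (P : zmodType) (b : M -> N -> P),
     balanced b -> tlift b t = tlift b u) -> t = u.
Proof. by move=> h; rewrite -[t]reprK -[u]reprK; apply: tens_pi_eq => P b /h. Qed.

Lemma tsum_cat (P : zmodType) (b : M -> N -> P) s t :
  tsum b (s ++ t) = tsum b s + tsum b t.
Proof. by rewrite /tsum big_cat. Qed.

Lemma balanced0l (P : zmodType) (b : M -> N -> P) n : balanced b -> b 0 n = 0.
Proof. by case=> h _ _; apply: (addrI (b 0 n)); rewrite -h !addr0. Qed.
Lemma balanced0r (P : zmodType) (b : M -> N -> P) m : balanced b -> b m 0 = 0.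
Proof. by case=> _ h _; apply: (addrI (b m 0)); rewrite -h !addr0. Qed.
Lemma balancedNl (P : zmodType) (b : M -> N -> P) m n :
  balanced b -> b (- m) n = - b m n.
Proof.
move=> bb; apply: (addrI (b m n)); have [h _ _] := bb.
by rewrite -h !subrr balanced0l.
Qed.

Definition tens_zero : tens := \pi_tens [::].
Definition tens_opp (t : tens) : tens :=
  \pi_tens [seq (- x.1, x.2) | x <- repr t].
Definition tens_add (t u : tens) : tens := \pi_tens (repr t ++ repr u).

Lemma tlift_zero (P : zmodType) (b : M -> N -> P) :
  balanced b -> tlift b tens_zero = 0.
Proof. by move=> bb; rewrite tlift_pi // /tsum big_nil. Qed.
Lemma tlift_opp (P : zmodType) (b : M -> N -> P) t :
  balanced b -> tlift b (tens_opp t) = - tlift b t.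
Proof.
move=> bb; rewrite tlift_pi // /tsum big_map -sumrN.
by apply: eq_bigr => x _; rewrite balancedNl.
Qed.
Lemma tlift_add (P : zmodType) (b : M -> N -> P) t u :
  balanced b -> tlift b (tens_add t u) = tlift b t + tlift b u.
Proof. by move=> bb; rewrite tlift_pi // tsum_cat. Qed.

Fact tens_addA : associative tens_add.
Proof.
by move=> t u v; apply: tens_ext => P b bb; rewrite !tlift_add // addrA.
Qed.
Fact tens_addC : commutative tens_add.
Proof. by move=> t u; apply: tens_ext => P b bb; rewrite !tlift_add // addrC. Qed.
Fact tens_add0 : left_id tens_zero tens_add.
Proof.
by move=> t; apply: tens_ext => P b bb; rewrite tlift_add // tlift_zero // add0r.
Qed.
Fact tens_addN : left_inverse tens_zero tens_opp tens_add.
Proof.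
move=> t; apply: tens_ext => P b bb.
by rewrite tlift_add // tlift_opp // tlift_zero // addNr.
Qed.
HB.instance Definition _ :=
  GRing.isZmodule.Build tens tens_addA tens_addC tens_add0 tens_addN.

Lemma tliftD (P : zmodType) (b : M -> N -> P) t u :
  balanced b -> tlift b (t + u) = tlift b t + tlift b u.
Proof. exact: tlift_add. Qed.
Lemma tliftB (P : zmodType) (b : M -> N -> P) t u :
  balanced b -> tlift b (t - u) = tlift b t - tlift b u.
Proof. by move=> bb; rewrite tliftD //; congr (_ + _); exact: tlift_opp. Qed.
Lemma tlift_pure (P : zmodType) (b : M -> N -> P) m n :
  balanced b -> tlift b (pure m n) = b m n.
Proof. by move=> bb; rewrite tlift_pi // /tsum big_seq1. Qed.

Lemma pure_balanced : balanced pure.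
Proof.
split=> *; apply: tens_ext => P b bb; have [h1 h2 h3] := bb;
  by rewrite ?tliftD // !tlift_pure.
Qed.

Lemma tens_sum (t : tens) : t = \sum_(x <- repr t) pure x.1 x.2.
Proof.
apply: tens_ext => P b bb; rewrite {1}/tlift /tsum.
elim: (repr t) => [|x s IH]; first by rewrite !big_nil -[RHS]/(tlift b tens_zero) tlift_zero.
by rewrite !big_cons tliftD // tlift_pure // IH.
Qed.

Lemma tens_ind (Q : tens -> Prop) :
  Q 0 -> (forall t u, Q t -> Q u -> Q (t + u)) ->
  (forall m n, Q (pure m n)) -> forall t, Q t.
Proof. by move=> Q0 QD Qp t; rewrite (tens_sum t); apply: big_ind. Qed.

End Tensor.
Arguments pure {K M N}.

Definition tmap (K : comPzRingType) (M M' N : lmodType K) (f : M -> M') :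
  tens M N -> tens M' N := tlift (fun m n => pure (f m) n).

(* The F-vector space M (x)_k F, for M a module over k and F a k-algebra. *)
Definition bchange (k F : comPzRingType) (i : {rmorphism k -> F})
  (M : lmodType k) : Type := tens M (asmod (restr i (base F))).
Section BaseChange.
Variables (k F : comPzRingType) (i : {rmorphism k -> F}) (M : lmodType k).
HB.instance Definition _ := GRing.Zmodule.on (bchange i M).
Definition bchange_scale (a : F) (t : bchange i M) : bchange i M :=
  tlift (fun m (l : asmod (restr i (base F))) =>
           pure m ((a : asmod (restr i (base F))) * l)) t.
Fact bchange_scale_balanced (a : F) :
  @balanced _ M (asmod (restr i (base F))) (tens M (asmod (restr i (base F))))
    (fun m l => pure m ((a : asmod (restr i (base F))) * l)).
Proof.
have [h1 h2 h3] := @pure_balanced k M (asmod (restr i (base F))).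
split=> [m m' n|m n n'|c m n]; rewrite ?mulrDr ?h1 ?h2 // h3; congr pure.
exact: mulrCA.
Qed.
Lemma bchange_scale_pure a m (l : F) :
  bchange_scale a (pure m (l : asmod (restr i (base F)))) =
  pure m (a * l : asmod (restr i (base F))).
Proof. by rewrite /bchange_scale tlift_pure //; exact: bchange_scale_balanced. Qed.
Fact bchange_scaleDr : right_distributive bchange_scale +%R.
Proof. by move=> a t u; exact: tliftD (bchange_scale_balanced a). Qed.
Fact bchange_scale0 a : bchange_scale a 0 = 0.
Proof. exact: tlift_zero (bchange_scale_balanced a). Qed.
Fact bchange_scaleA a b t :
  bchange_scale a (bchange_scale b t) = bchange_scale (a * b) t.
Proof.
elim/tens_ind: t => [|t u IHt IHu|m n]; first by rewrite !bchange_scale0.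
  by rewrite !bchange_scaleDr IHt IHu.
by rewrite !bchange_scale_pure mulrA.
Qed.
Fact bchange_scale1 : left_id 1 bchange_scale.
Proof.
move=> t; elim/tens_ind: t => [|t u IHt IHu|m n]; first by rewrite !bchange_scale0.
  by rewrite !bchange_scaleDr IHt IHu.
by rewrite !bchange_scale_pure mul1r.
Qed.
Fact bchange_scaleDl t : {morph bchange_scale^~ t : a b / a + b}.
Proof.
move=> a b /=; elim/tens_ind: t => [|t u IHt IHu|m n].
- by rewrite !bchange_scale0 addr0.
- by rewrite !bchange_scaleDr IHt IHu addrACA.
have [_ h2 _] := @pure_balanced k M (asmod (restr i (base F))).
by rewrite !bchange_scale_pure mulrDl h2.
Qed.
HB.instance Definition _ := GRing.Zmodule_isLmodule.Build F (bchange i M)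
  bchange_scaleA bchange_scale1 bchange_scaleDr bchange_scaleDl.
End BaseChange.

Definition tensA (K : comPzRingType) (B C : algebra K) : Type :=
  tens (asmod B) (asmod C).
Section TensorAlgebra.
Variables (K : comPzRingType) (B C : algebra K).
Local Notation T := (tensA B C).
HB.instance Definition _ := GRing.Zmodule.on T.

Definition purea (b : B) (c : C) : T := pure (b : asmod B) (c : asmod C).

Definition tensA_mulp (t : T) (b' : B) (c' : C) : T :=
  tlift (fun (b : asmod B) (c : asmod C) => purea ((b : B) * b') ((c : C) * c')) t.
Definition tensA_mul (t u : T) : T :=
  tlift (fun (b' : asmod B) (c' : asmod C) => tensA_mulp t b' c') u.
Definition tensA_one : T := purea 1 1.

Lemma pureaDl b b' c : purea (b + b') c = purea b c + purea b' c.
Proof. by have [h _ _] := @pure_balanced K (asmod B) (asmod C); exact: h. Qed.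
Lemma pureaDr b c c' : purea b (c + c') = purea b c + purea b c'.
Proof. by have [_ h _] := @pure_balanced K (asmod B) (asmod C); exact: h. Qed.
Lemma pureaZ a b c : purea (alg_map B a * b) c = purea b (alg_map C a * c).
Proof. by have [_ _ h] := @pure_balanced K (asmod B) (asmod C); exact: h. Qed.

Lemma tensA_mulp_balanced b' c' :
  @balanced _ (asmod B) (asmod C) T
    (fun b c => purea ((b : B) * b') ((c : C) * c')).
Proof.
split=> [m m' n|m n n'|a m n].
- by rewrite -pureaDl -mulrDl.
- by rewrite -pureaDr -mulrDl.
- by rewrite -[_ *: m]/(alg_map B a * _) -[_ *: n]/(alg_map C a * _)
    -!mulrA pureaZ.
Qed.

Lemma tensA_mulpp b c b' c' :
  tensA_mulp (purea b c) b' c' = purea (b * b') (c * c').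
Proof. exact: tlift_pure (tensA_mulp_balanced b' c'). Qed.
Lemma tensA_mulpD t u b' c' :
  tensA_mulp (t + u) b' c' = tensA_mulp t b' c' + tensA_mulp u b' c'.
Proof. exact: tliftD (tensA_mulp_balanced b' c'). Qed.
Lemma tensA_mulp0 b' c' : tensA_mulp 0 b' c' = 0.
Proof. exact: tlift_zero (tensA_mulp_balanced b' c'). Qed.

Lemma tensA_mul_balanced t :
  @balanced _ (asmod B) (asmod C) T (fun b' c' => tensA_mulp t b' c').
Proof.
elim/(@tens_ind K (asmod B) (asmod C)): t =>
    [|t u [t1 t2 t3] [u1 u2 u3]|b c].
- by split=> *; rewrite !tensA_mulp0 ?addr0.
- split=> *; rewrite !tensA_mulpD.
  + by rewrite t1 u1 addrACA.
  + by rewrite t2 u2 addrACA.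
  + by rewrite t3 u3.
split=> [m m' n|m n n'|a m n]; rewrite -/(purea b c) !tensA_mulpp.
- by rewrite mulrDr pureaDl.
- by rewrite mulrDr pureaDr.
- rewrite -[_ *: m]/(alg_map B a * (m : B)) -[_ *: n]/(alg_map C a * (n : C)).
  by rewrite mulrCA pureaZ [in RHS]mulrCA.
Qed.

Lemma tensA_ind (Q : T -> Prop) :
  Q 0 -> (forall t u, Q t -> Q u -> Q (t + u)) ->
  (forall b c, Q (purea b c)) -> forall t, Q t.
Proof. exact: tens_ind. Qed.

Lemma tensA_mul_pure b c b' c' :
  tensA_mul (purea b c) (purea b' c') = purea (b * b') (c * c').
Proof.
rewrite -tensA_mulpp; exact: tlift_pure (tensA_mul_balanced (purea b c)).
Qed.
Fact tensA_mulDr t u v : tensA_mul t (u + v) = tensA_mul t u + tensA_mul t v.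
Proof. exact: tliftD (tensA_mul_balanced t). Qed.
Fact tensA_mulr0 t : tensA_mul t 0 = 0.
Proof. exact: tlift_zero (tensA_mul_balanced t). Qed.
Fact tensA_mulDl : left_distributive tensA_mul +%R.
Proof.
move=> t u v; elim/tensA_ind: v => [|v w IHv IHw|b c].
- by rewrite !tensA_mulr0 addr0.
- by rewrite !tensA_mulDr IHv IHw addrACA.
- rewrite /tensA_mul /purea !(tlift_pure _ _ (tensA_mul_balanced _)).
  exact: tensA_mulpD.
Qed.
Fact tensA_mul0r t : tensA_mul 0 t = 0.
Proof.
by apply: (addrI (tensA_mul 0 t)); rewrite -tensA_mulDl !addr0.
Qed.
Fact tensA_mulC : commutative tensA_mul.
Proof.
move=> t u; elim/tensA_ind: t => [|t v IHt IHv|b c].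
- by rewrite tensA_mulr0 tensA_mul0r.
- by rewrite tensA_mulDr tensA_mulDl IHt IHv.
elim/tensA_ind: u => [|u v IHu IHv|b' c'].
- by rewrite tensA_mulr0 tensA_mul0r.
- by rewrite tensA_mulDr tensA_mulDl IHu IHv.
by rewrite !tensA_mul_pure mulrC [c * _]mulrC.
Qed.
Fact tensA_mul1 : left_id tensA_one tensA_mul.
Proof.
move=> t; elim/tensA_ind: t => [|t u IHt IHu|b c].
- exact: tensA_mulr0.
- by rewrite tensA_mulDr IHt IHu.
by rewrite tensA_mul_pure !mul1r.
Qed.
Fact tensA_mulA : associative tensA_mul.
Proof.
move=> t u v; elim/tensA_ind: t => [|t t' IHt IHt'|b c].
- by rewrite !tensA_mul0r.
- by rewrite !tensA_mulDl IHt IHt'.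
elim/tensA_ind: u => [|u u' IHu IHu'|b' c'].
- by rewrite !(tensA_mul0r, tensA_mulr0).
- by rewrite !(tensA_mulDl, tensA_mulDr) IHu IHu'.
elim/tensA_ind: v => [|v v' IHv IHv'|b'' c''].
- by rewrite !tensA_mulr0.
- by rewrite !tensA_mulDr IHv IHv'.
by rewrite !tensA_mul_pure !mulrA.
Qed.
HB.instance Definition _ := GRing.Zmodule_isComPzRing.Build T
  tensA_mulA tensA_mulC tensA_mul1 tensA_mulDl.

Lemma pureaM b c b' c' : purea b c * purea b' c' = purea (b * b') (c * c').
Proof. exact: tensA_mul_pure. Qed.

Definition inla (b : B) : T := purea b 1.
Definition inra (c : C) : T := purea 1 c.
Fact inla_zmod : zmod_morphism inla.
Proof.
move=> b b'; apply: (addIr (inla b')).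
by rewrite /inla -pureaDl !subrK.
Qed.
Fact inla_monoid : monoid_morphism inla.
Proof. by split=> // b b'; rewrite /inla pureaM mulr1. Qed.
Fact inra_zmod : zmod_morphism inra.
Proof.
move=> c c'; apply: (addIr (inra c')).
by rewrite /inra -pureaDr !subrK.
Qed.
Fact inra_monoid : monoid_morphism inra.
Proof. by split=> // c c'; rewrite /inra pureaM mulr1. Qed.
HB.instance Definition _ := GRing.isZmodMorphism.Build B T inla inla_zmod.
HB.instance Definition _ := GRing.isMonoidMorphism.Build B T inla inla_monoid.
HB.instance Definition _ := GRing.isZmodMorphism.Build C T inra inra_zmod.
HB.instance Definition _ := GRing.isMonoidMorphism.Build C T inra inra_monoid.

Definition tens_alg : algebra K := @Algebra K T (inla \o alg_map B).

Lemma inla_inra a : inla (alg_map B a) = inra (alg_map C a).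
Proof. by rewrite /inla /inra -[alg_map B a]mulr1 pureaZ mulr1. Qed.

Section Copair.
Variables (R : algebra K) (g : alg_hom B R) (h : alg_hom C R).
Definition copair_fun : tens_alg -> R :=
  tlift (fun (b : asmod B) (c : asmod C) => g b * h c).
Lemma copair_balanced :
  @balanced _ (asmod B) (asmod C) R (fun b c => g b * h c).
Proof.
split=> [m m' n|m n n'|a m n]; rewrite ?rmorphD ?mulrDl ?mulrDr //.
rewrite -[_ *: m]/(alg_map B a * (m : B)) -[_ *: n]/(alg_map C a * (n : C)).
by rewrite !rmorphM !hom_alg mulrCA mulrA.
Qed.
Lemma copair_pure b c : copair_fun (purea b c) = g b * h c.
Proof. exact: tlift_pure copair_balanced. Qed.
Fact copair_zmod : zmod_morphism copair_fun.
Proof. by move=> t u; exact: tliftB copair_balanced. Qed.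
HB.instance Definition _ :=
  GRing.isZmodMorphism.Build tens_alg R copair_fun copair_zmod.
Fact copair_monoid : monoid_morphism copair_fun.
Proof.
split=> [|t u].
  by rewrite -[1]/(purea 1 1) copair_pure !rmorph1 mulr1.
elim/tensA_ind: t => [|t t' IHt IHt'|b c].
- by rewrite mul0r raddf0 mul0r.
- by rewrite mulrDl !raddfD /= mulrDl IHt IHt'.
elim/tensA_ind: u => [|u u' IHu IHu'|b' c'].
- by rewrite mulr0 raddf0 mulr0.
- by rewrite mulrDr !raddfD /= mulrDr IHu IHu'.
by rewrite pureaM !copair_pure !rmorphM mulrACA.
Qed.
HB.instance Definition _ :=
  GRing.isMonoidMorphism.Build tens_alg R copair_fun copair_monoid.
Lemma copair_alg_subproof a : copair_fun (alg_map tens_alg a) = alg_map R a.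
Proof. by rewrite copair_pure rmorph1 mulr1 hom_alg. Qed.
Definition copair : alg_hom tens_alg R := AlgHom copair_alg_subproof.
End Copair.
End TensorAlgebra.
Arguments inla {K} B C.
Arguments inra {K} B C.

(* The dual numbers C[e], with (c, d) standing for c + d e. *)
Definition dual_ring (C : comPzRingType) : Type := (C * C)%type.
Section DualRing.
Variable C : comPzRingType.
Local Notation D := (dual_ring C).
HB.instance Definition _ := GRing.Zmodule.on D.
Definition dual_mul (x y : D) : D := (x.1 * y.1, x.1 * y.2 + x.2 * y.1).
Definition dual_one : D := (1, 0).
Fact dual_mulA : associative dual_mul.
Proof.
move=> x y z; rewrite /dual_mul /=; congr pair; first by rewrite mulrA.
by rewrite !mulrDr !mulrDl !mulrA addrA.
Qed.
Fact dual_mulC : commutative dual_mul.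
Proof.
move=> x y; rewrite /dual_mul mulrC; congr pair.
by rewrite addrC [x.2 * _]mulrC [x.1 * _]mulrC.
Qed.
Fact dual_mul1 : left_id dual_one dual_mul.
Proof. by case=> a b; rewrite /dual_mul /= !mul1r mul0r addr0. Qed.
Fact dual_mulDl : left_distributive dual_mul +%R.
Proof.
by move=> x y z; rewrite /dual_mul /= !mulrDl; congr pair; rewrite addrACA.
Qed.
HB.instance Definition _ := GRing.Zmodule_isComPzRing.Build D
  dual_mulA dual_mulC dual_mul1 dual_mulDl.
Definition dual_cst (c : C) : D := (c, 0).
Fact dual_cst_zmod : zmod_morphism dual_cst.
Proof. by move=> a b; congr pair; rewrite subr0. Qed.
Fact dual_cst_monoid : monoid_morphism dual_cst.
Proof.
split=> // a b; rewrite -[RHS]/(dual_mul (dual_cst a) (dual_cst b)) /dual_mul /=.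
by rewrite mulr0 mul0r addr0.
Qed.
HB.instance Definition _ := GRing.isZmodMorphism.Build C D dual_cst dual_cst_zmod.
HB.instance Definition _ :=
  GRing.isMonoidMorphism.Build C D dual_cst dual_cst_monoid.
End DualRing.

Definition dual (K : comPzRingType) (C : algebra K) : algebra K :=
  @Algebra K (dual_ring C) (@dual_cst C \o alg_map C).

Section AffineGroups.
Variable K : comPzRingType.

Definition conv_by (A : algebra K) (mu : alg_hom A (tens_alg A A))
  (R : algebra K) (g h : alg_hom A R) : alg_hom A R :=
  hom_comp (copair g h) mu.

(* An affine group scheme Spec A: the R-valued points alg_hom A R form a
   group, with the operations induced by the Hopf algebra structure maps. *)
Record affine_group := AffineGroup {
  coord :> algebra K;
  comul : alg_hom coord (tens_alg coord coord);
  counit : alg_hom coord (base K);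
  antipode : alg_hom coord coord;
  pt_mulA : forall (R : algebra K) (g h l : alg_hom coord R),
    conv_by comul g (conv_by comul h l) =1 conv_by comul (conv_by comul g h) l;
  pt_mul1 : forall (R : algebra K) (g : alg_hom coord R),
    conv_by comul (hom_comp (hom_str R) counit) g =1 g;
  pt_mulr1 : forall (R : algebra K) (g : alg_hom coord R),
    conv_by comul g (hom_comp (hom_str R) counit) =1 g;
  pt_mulV : forall (R : algebra K) (g : alg_hom coord R),
    conv_by comul (hom_comp g antipode) g =1 hom_comp (hom_str R) counit;
  pt_mulrV : forall (R : algebra K) (g : alg_hom coord R),
    conv_by comul g (hom_comp g antipode) =1 hom_comp (hom_str R) counit }.

Variable H : affine_group.

Definition pt_mul (R : algebra K) (g h : alg_hom H R) : alg_hom H R :=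
  conv_by (comul H) g h.
Definition pt_one (R : algebra K) : alg_hom H R :=
  hom_comp (hom_str R) (counit H).

Definition act_by (X : algebra K) (r : alg_hom X (tens_alg H X))
  (R : algebra K) (g : alg_hom H R) (x : alg_hom X R) : alg_hom X R :=
  hom_comp (copair g x) r.

(* A left action of H on Spec X, i.e. on the sets of points alg_hom X R. *)
Record action (X : algebra K) := Action {
  coact : alg_hom X (tens_alg H X);
  act_one : forall (R : algebra K) (x : alg_hom X R),
    act_by coact (pt_one R) x =1 x;
  act_mul : forall (R : algebra K) (g h : alg_hom H R) (x : alg_hom X R),
    act_by coact (pt_mul g h) x =1 act_by coact g (act_by coact h x) }.

Definition act (X : algebra K) (r : action X) (R : algebra K)
  (g : alg_hom H R) (x : alg_hom X R) : alg_hom X R := act_by (coact r) g x.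

End AffineGroups.
Arguments pt_one {K H}.

Definition finite_type (k : fieldType) (A : algebra k) : Prop :=
  exists (n : nat) (x : 'I_n -> A), forall a : A,
  exists q : {mpoly k[n]},
    a = \sum_(m <- msupp q)
          alg_map A q@_m * \prod_(j < n) x j ^+ m j.

(* The relative Frobenius of Spec A over k corresponds to
   c (x) a |-> c a^p on the Frobenius twist of A; it is trivial when it agrees
   with the neutral morphism c (x) a |-> c counit(a)^p. *)
Definition frobenius_trivial (k : fieldType) (p : nat)
  (H : affine_group k) : Prop :=
  forall a : H, a ^+ p = alg_map H (counit H a ^+ p : k).

Definition height_one (k : fieldType) (p : nat) (H : affine_group k) : Prop :=
  finite_type H /\ frobenius_trivial p H.

(* Tangent vectors at the neutral element with values in C. K-linearity follows
   from the Leibniz rule and the vanishing on constants. *)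
Section PointDerivations.
Variables (K : comPzRingType) (H : affine_group K) (C : algebra K).

Definition is_pder (d : H -> asmod C) : bool :=
  `[< [/\ forall a b, d (a + b) = d a + d b,
          forall c, d (alg_map H c) = 0 &
          forall a b, d (a * b) =
            (counit H a : K) *: d b + (counit H b : K) *: d a] >].
Fact is_pder_submod : submod_closed is_pder.
Proof.
split; first by apply/asboolP; split=> *; rewrite ?addr0 ?scaler0 ?addr0.
move=> c d d' /asboolP[d1 d2 d3] /asboolP[e1 e2 e3].
apply/asboolP; split=> [a b|a|a b]; rewrite !fctE.
- by rewrite d1 e1 scalerDr addrACA.
- by rewrite d2 e2 scaler0 addr0.
- rewrite d3 e3 !scalerDr !scalerA addrACA.
  by rewrite [c * _]mulrC [c * counit H b]mulrC.
Qed.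
HB.instance Definition _ :=
  GRing.isSubmodClosed.Build K (H -> asmod C) is_pder is_pder_submod.

Record pder := Pder { pder_fun :> H -> asmod C; pder_subproof : is_pder pder_fun }.
HB.instance Definition _ := [isSub for pder_fun].
HB.instance Definition _ := [Choice of pder by <:].
HB.instance Definition _ := [SubChoice_isSubLmodule of pder by <:].

End PointDerivations.

Definition lie (K : comPzRingType) (H : affine_group K) : lmodType K :=
  pder H (base K).

(* The C[e]-valued point a |-> counit(a) + d(a) e of H. *)
Section PointOfDerivation.
Variables (K L : comPzRingType) (i : {rmorphism K -> L}).
Variables (H : affine_group K) (C : algebra L) (d : pder H (restr i C)).

Definition pder_point_fun (a : H) : restr i (dual C) :=
  (alg_map (restr i C) (counit H a), d a).
Lemma pderP :
  [/\ forall a b, d (a + b) = d a + d b,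
      forall c, d (alg_map H c) = 0 &
      forall a b, d (a * b) =
        (counit H a : K) *: d b + (counit H b : K) *: d a].
Proof. by apply/asboolP; exact: pder_subproof. Qed.
Fact pder_point_zmod : zmod_morphism pder_point_fun.
Proof.
move=> a b; have [dD _ _] := pderP; rewrite /pder_point_fun; congr pair.
  by rewrite !rmorphB.
by apply: (addIr (d b)); rewrite -dD !subrK.
Qed.
Fact pder_point_monoid : monoid_morphism pder_point_fun.
Proof.
have [_ d1 dM] := pderP; rewrite /pder_point_fun; split => [|a b].
  by rewrite !rmorph1; congr pair; rewrite -(rmorph1 (alg_map H)) d1.
rewrite -[RHS]/(dual_mul _ _) /dual_mul /= !rmorphM dM; congr pair.
by congr (_ + _); exact: mulrC.
Qed.
HB.instance Definition _ :=
  GRing.isZmodMorphism.Build H (restr i (dual C)) pder_point_fun pder_point_zmod.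
HB.instance Definition _ :=
  GRing.isMonoidMorphism.Build H (restr i (dual C)) pder_point_fun
    pder_point_monoid.
Lemma pder_point_alg c :
  pder_point_fun (alg_map H c) = alg_map (restr i (dual C)) c.
Proof.
by have [_ d1 _] := pderP; rewrite /pder_point_fun hom_alg d1.
Qed.
Definition pder_point : alg_hom H (restr i (dual C)) := AlgHom pder_point_alg.
End PointOfDerivation.

Section Dimension.
Variables (K : fieldType) (V : lmodType K).
Definition has_codim (W : V -> Prop) (n : nat) : Prop :=
  exists b : 'I_n -> V, forall v : V,
  exists! a : 'rV[K]_n, W (v - \sum_j a ord0 j *: b j).
Definition has_dim (n : nat) : Prop :=
  exists b : 'I_n -> V, forall v : V,
  exists! a : 'rV[K]_n, v = \sum_j a ord0 j *: b j.
End Dimension.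
Arguments has_dim {K} V n.

Section Fppf.
Variables (R R' : comNzRingType) (t : {rmorphism R -> R'}).
Local Notation N := (asmod (Algebra t)).
Definition flat : Prop :=
  forall (M M' : lmodType R) (f : {linear M -> M'}),
    injective f -> injective (@tmap R M M' N f).
Definition faithfully_flat : Prop :=
  flat /\ forall M : lmodType R,
    (forall x : tens M N, x = 0) -> forall m : M, m = 0.
Definition finite_presentation : Prop :=
  exists (n : nat) (x : 'I_n -> R'),
    (forall y : R', exists q : {mpoly R[n]}, mmap t x q = y) /\
    exists (m : nat) (r : 'I_m -> {mpoly R[n]}),
    forall q : {mpoly R[n]}, mmap t x q = 0 <->
      exists c : 'I_m -> {mpoly R[n]}, q = \sum_j c j * r j.
Definition fppf : Prop := faithfully_flat /\ finite_presentation.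
End Fppf.

Section Inertia.
Variables (k F : fieldType) (i : {rmorphism k -> F}) (H : affine_group k).

Definition Fk : algebra k := restr i (base F).
Definition HF (R : algebra F) : Type := alg_hom H (restr i R).

(* Y is the fppf sheaf quotient of H_F by the subgroup functor N, along o: the
   fibres of o are the right-translation cosets of N, so that the presheaf
   quotient embeds in Y, and every point of Y lifts after an fppf base change.
   The last clause is void for the zero ring, which comNzRingType excludes. *)
Definition is_quotient (N : forall R : algebra F, HF R -> Prop)
  (Y : algebra F) (o : forall R : algebra F, HF R -> alg_hom Y R) : Prop :=
  [/\ forall (R R' : algebra F) (u : alg_hom R R') (g : HF R),
        o R' (hom_comp (hom_restr i u) g) =1 hom_comp u (o R g),
      forall (R : algebra F) (g g' : HF R),
        o R g =1 o R g' <-> exists n : HF R, N R n /\ g' =1 pt_mul g n &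
      forall (R : comNzRingType) (s : {rmorphism F -> R})
          (y : alg_hom Y (Algebra s)),
        exists (R' : comNzRingType) (t : {rmorphism R -> R'}), fppf t /\
        exists g : HF (Algebra (t \o s)),
          o (Algebra (t \o s)) g =1 t \o y].

Variable r : action H Fk.

Section ScaledDerivation.
Variables (d : lie H) (l : F).
Definition lift_pder_fun (a : H) : asmod Fk := l * i (d a).
Fact lift_pder_subproof : is_pder lift_pder_fun.
Proof.
have [dD d1 dM] := (asboolP _ (pder_subproof d)).
apply/asboolP; rewrite /lift_pder_fun; split=> [a b|c|a b].
- by rewrite dD rmorphD mulrDr.
- by rewrite d1 rmorph0 mulr0.
rewrite dM rmorphD mulrDr; congr (_ + _).
  by rewrite -[_ *: d b]/(counit H a * d b) rmorphM mulrCA.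
by rewrite -[_ *: d a]/(counit H b * d a) rmorphM mulrCA.
Qed.
Definition lift_pder : pder H Fk := Pder lift_pder_subproof.
End ScaledDerivation.

(* The derivation of F induced by d in Lie(H): the point counit + d e of H moves
   the inclusion of F in F[e] to x |-> x + (vf d x) e. The resulting map Lie(H) ->
   Der_k(F) is bracket-reversing, since H acts on the left of Spec F; passing to
   the homomorphism - vf would change nothing below. *)
Definition vf_point (d : lie H) : alg_hom Fk (restr i (dual (base F))) :=
  act r (@pder_point k F i H (base F) (lift_pder d 1))
    (hom_restr i (hom_str (dual (base F)))).
Definition vf (d : lie H) (x : F) : F := (vf_point d x).2.

Definition fixed (x : F) : bool := `[< forall d : lie H, vf d x = 0 >].
Lemma vf_alg d (c : k) : vf d (i c) = 0.
Proof. by rewrite /vf (hom_alg (vf_point d) c). Qed.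
Lemma vfB d x y : vf d (x - y) = vf d x - vf d y.
Proof. by rewrite /vf rmorphB. Qed.
Lemma vfM d x y :
  vf d (x * y) = (vf_point d x).1 * vf d y + vf d x * (vf_point d y).1.
Proof. by rewrite /vf rmorphM. Qed.
Fact fixed_divring : divring_closed fixed.
Proof.
split.
- by apply/asboolP => d; rewrite -(rmorph1 i) vf_alg.
- move=> x y /asboolP hx /asboolP hy; apply/asboolP=> d.
  by rewrite vfB hx hy subrr.
move=> x y /asboolP hx /asboolP hy; apply/asboolP => d.
rewrite vfM hx mul0r addr0.
have [->|y0] := eqVneq y 0.
  by rewrite invr0 -[X in vf d X](rmorph0 i) vf_alg mulr0.
suff -> : vf d y^-1 = 0 by rewrite mulr0.
have e1 : (vf_point d y^-1).1 * (vf_point d y).1 = 1.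
  transitivity (vf_point d (y^-1 * y)).1; first by rewrite rmorphM.
  by rewrite mulVf // rmorph1.
have := vfM d y^-1 y; rewrite mulVf // -[X in vf d X = _](rmorph1 i) vf_alg hy mulr0 add0r.
move=> /(congr1 ( *%R^~ (vf_point d y^-1).1)).
by rewrite mul0r -mulrA [_.1 * _.1]mulrC e1 mulr1 => <-.
Qed.
HB.instance Definition _ := GRing.isDivringClosed.Build F fixed fixed_divring.

(* E = F^h *)
Record fixed_field := FixedElt { fixed_val :> F; _ : fixed fixed_val }.
HB.instance Definition _ := [isSub for fixed_val].
HB.instance Definition _ := [Choice of fixed_field by <:].
HB.instance Definition _ :=
  [SubChoice_isSubIntegralDomain of fixed_field by <:].
HB.instance Definition _ := [SubIntegralDomain_isSubField of fixed_field by <:].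

Definition FE : algebra fixed_field :=
  @Algebra fixed_field F (val : {rmorphism fixed_field -> F}).

(* Z_F = Spec (F (x)_E F), over F through l |-> 1 (x) l. *)
Definition ZF : algebra F :=
  @Algebra F (tensA FE FE) (inra FE FE : {rmorphism FE -> tensA FE FE}).

(* The point z_0: x (x) y |-> x y. *)
Lemma z0_alg (l : F) :
  copair (hom_id FE) (hom_id FE) (alg_map ZF l) = alg_map (base F) l.
Proof.
transitivity (hom_id FE 1 * hom_id FE (l : FE)); first exact: copair_pure.
by rewrite rmorph1 mul1r.
Qed.
Definition z0 : alg_hom ZF (base F) :=
  @AlgHom F ZF (base F)
    (hom_map (copair (hom_id FE) (hom_id FE))) z0_alg.
Definition z0_at (R : algebra F) : alg_hom ZF R := hom_comp (hom_str R) z0.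

(* A point of Z_F is in particular a point of Spec F over k. *)
Section ToSpecF.
Variables (R : algebra F) (z : alg_hom ZF R).
Lemma fixed_alg (c : k) : fixed (i c).
Proof. by apply/asboolP => d; rewrite vf_alg. Qed.
Definition toF_map : {rmorphism FE -> R} := hom_map z \o inla FE FE.
Lemma toF_alg (c : k) : toF_map (alg_map Fk c) = alg_map (restr i R) c.
Proof.
rewrite /= -(hom_alg z) /=; congr (hom_map z _).
exact: (inla_inra FE FE (FixedElt (fixed_alg c))).
Qed.
Definition toF : alg_hom Fk (restr i R) :=
  @AlgHom k Fk (restr i R) toF_map toF_alg.
End ToSpecF.

(* a is the action of H_F on Z_F deduced by base change from the action of H on
   Spec F; it is determined by this compatibility. *)
Definition is_base_changed_action
  (a : forall R : algebra F, HF R -> alg_hom ZF R -> alg_hom ZF R) : Prop :=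
  forall (R : algebra F) (g : HF R) (z : alg_hom ZF R),
    toF (a R g z) =1 act r g (toF z).

Section Stabilizer.
Variable a : forall R : algebra F, HF R -> alg_hom ZF R -> alg_hom ZF R.
Definition orbit_map (R : algebra F) (g : HF R) : alg_hom ZF R := a g (z0_at R).
Definition inertia (R : algebra F) (g : HF R) : Prop :=
  a g (z0_at R) =1 z0_at R.
End Stabilizer.

Definition lieF : lmodType F := bchange i (lie H).

(* The identification of h (x)_k F with Lie(H_F), and the canonical map to
   h.F inside Der_k(F). *)
Definition lieF_pder (t : lieF) : pder H Fk :=
  tlift (fun (d : lie H) (l : asmod Fk) => lift_pder d (l : F))
    (t : tens (lie H) (asmod Fk)).
Definition lieF_vf (t : lieF) : F -> F :=
  tlift (fun (d : lie H) (l : asmod Fk) => fun x : F => (l : F) * vf d x)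
    (t : tens (lie H) (asmod Fk)).

Lemma lieF_pder_pure (d : lie H) (l : F) :
  lieF_pder (pure d (l : asmod Fk)) = lift_pder d l.
Proof.
apply: tlift_pure; split=> [d' e m|d' m n|c d' m];
  apply: val_inj; apply/funext => a /=.
- by rewrite /lift_pder_fun -[(d' + e) a]/(d' a + e a) rmorphD mulrDr.
- by rewrite /lift_pder_fun mulrDl.
- rewrite /lift_pder_fun -[(c *: d') a]/((c : k) * d' a) rmorphM.
  by rewrite -[c *: m]/(i c * (m : F)) mulrA [m * _]mulrC.
Qed.

Lemma vf_pure (d : lie H) (a : H) (f : Fk) :
  (copair (@pder_point k F i H (base F) (lift_pder d 1))
    (hom_restr i (hom_str (dual (base F)))) (purea a f)).2 = i (d a) * f.
Proof.
have := congr1 snd (copair_pure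
  (@pder_point k F i H (base F) (lift_pder d 1))
  (hom_restr i (hom_str (dual (base F)))) a f).
by move=> ->; rewrite -[LHS]/(_ * 0 + (1 * i (d a)) * f) mulr0 add0r mul1r.
Qed.

Lemma vf_lin (c : k) (d e : lie H) x : vf (c *: d + e) x = i c * vf d x + vf e x.
Proof.
rewrite /vf /vf_point /act /act_by /=.
elim/(@tensA_ind k H Fk): (coact r x) => [|t u IHt IHu|a f].
- by rewrite !rmorph0 /= mulr0 addr0.
- by rewrite !rmorphD /= IHt IHu mulrDr addrACA.
rewrite !vf_pure -[(c *: d + e) a]/((c : k) * d a + e a).
by rewrite rmorphD rmorphM mulrDl mulrA.
Qed.

Lemma lieF_vf_pure (d : lie H) (l : F) :
  lieF_vf (pure d (l : asmod Fk)) = fun x => l * vf d x.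
Proof.
apply: tlift_pure; split=> [d' e m|d' m n|c d' m]; apply/funext => x.
- by have := vf_lin 1 d' e x; rewrite scale1r rmorph1 mul1r fctE => ->; rewrite mulrDr.
- by rewrite fctE mulrDl.
- have := vf_lin c d' 0 x; have := vf_lin 1 0 0 x.
  rewrite scale1r addr0 rmorph1 mul1r -[LHS]add0r => /addIr <-.
  by rewrite !addr0 => ->; rewrite -[c *: m]/(i c * (m : F)) mulrA [m * _]mulrC.
Qed.

Definition lie_inertia
  (a : forall R : algebra F, HF R -> alg_hom ZF R -> alg_hom ZF R)
  (t : lieF) : Prop :=
  inertia a (@pder_point k F i H (base F) (lieF_pder t)).

Definition is_Der_E (D : F -> F) : Prop :=
  [/\ forall x y, D (x + y) = D x + D y,
      forall x y, D (x * y) = x * D y + D x * y &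
      forall e : fixed_field, D (fixed_val e) = 0].

Definition F_span (D : F -> F) : Prop :=
  exists (n : nat) (l : 'I_n -> F) (d : 'I_n -> lie H),
    D =1 fun x => \sum_j l j * vf (d j) x.

End Inertia.
Arguments orbit_map {k F i H r} a R g.
Arguments inertia {k F i H r} a R g.

(* Main.v *)
(* Write S for the coordinate ring of H_F and rho : F -> S for the coaction. Since
   H has height one, S is a truncated polynomial algebra F[w_1..w_n]/(w_j^p) in
   any coordinates w_j at the origin: invariant derivations dual to the w_j act
   on polynomials in the w_j as partial derivatives modulo the nilpotent
   augmentation ideal.
   Left multiplication by tangent vectors shows that rho e is constant for e in
   E, so H_F acts on Z_F. Choose z_1..z_c in F whose values separate the space
   h.F of dimension c, and complete the w_j = rho z_j - z_j to coordinates. The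
   subring generated by rho F and F is killed by the derivations coming from
   h_F^inert, hence lies in F[w_1..w_c]; by the Galois-type injectivity of
   F (x)_E F -> S this forces F = E[z_1..z_c]. Derivations D_j in h.F dual to the
   z_j then give [F : E] = p^c and Der_E(F) = h.F. Finally the retraction
   w_j |-> z_j (x) 1 - 1 (x) z_j for j <= c, w_j |-> 0 for j > c, is a section of
   the orbit morphism, which is therefore surjective already as a map of
   presheaves. *)
From HB Require Import structures.
From mathcomp Require Import mpoly.
Require Import Defs.
From mathcomp Require Import all_boot all_algebra ring.
From mathcomp Require Import boolp functions.
Set Implicit Arguments.
Unset Strict Implicit.
Unset Printing Implicit Defensive.
Import GRing.Theory.
Local Open Scope ring_scope.

(** * Polynomial evaluation and derivations *)

Section MapMpoly.
Variables (K S : comNzRingType) (f : {rmorphism K -> S}).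

Lemma mmapXU n (w : 'I_n -> S) i : mmap f w 'X_i = w i.
Proof. by rewrite mmapX mmap1U. Qed.

Lemma mmap_closed n (w : 'I_n -> S) (Q : S -> Prop) :
  (forall c, Q (f c)) -> (forall i, Q (w i)) ->
  (forall u v, Q u -> Q v -> Q (u + v)) ->
  (forall u v, Q u -> Q v -> Q (u * v)) -> forall q, Q (mmap f w q).
Proof.
move=> Qc Qw QD QM q; rewrite /mmap.
apply: big_ind => [||m _]; first by rewrite -(rmorph0 f).
  exact: QD.
apply: (QM) => //; apply: big_ind => [||j _]; first by rewrite -(rmorph1 f).
  exact: QM.
elim: (m j) => [|k IH]; first by rewrite expr0 -(rmorph1 f).
by rewrite exprS; apply: QM.
Qed.

Definition kderiv (D : S -> S) : Prop :=
  [/\ forall u v, D (u + v) = D u + D v,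
      forall u v, D (u * v) = u * D v + D u * v & forall c, D (f c) = 0].

Lemma kderiv0 D : kderiv D -> D 0 = 0.
Proof. by case=> _ _ h; rewrite -{1}(rmorph0 f) h. Qed.

(** The chain rule: in [q], both sides are additive and obey the Leibniz rule, so constants and
    variables suffice. *)
Lemma kderiv_mmap D n (w : 'I_n -> S) q : kderiv D ->
  D (mmap f w q) = \sum_i mmap f w (mderiv i q) * D (w i).
Proof.
move=> hD; have [DD DM Dc] := hD.
pose Q q := D (mmap f w q) = \sum_i mmap f w (mderiv i q) * D (w i).
have QD q1 q2 : Q q1 -> Q q2 -> Q (q1 + q2).
  rewrite /Q mmapD DD => -> ->; rewrite -big_split; apply: eq_bigr => i _ /=.
  by rewrite -mulrDl mderivD mmapD.
have QM q1 q2 : Q q1 -> Q q2 -> Q (q1 * q2).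
  rewrite /Q rmorphM DM => -> ->; rewrite mulr_sumr mulr_suml -big_split /=.
  apply: eq_bigr => i _; rewrite mderivM mmapD !rmorphM /= mulrDl addrC.
  by rewrite !mulrA; congr (_ + _); rewrite mulrAC.
have QC c : Q c%:MP.
  by rewrite /Q mmapC Dc big1 // => i _; rewrite mderivC mmap0 mul0r.
have QX i : Q 'X_i.
  rewrite /Q mmapXU (bigD1 i) //= big1 => [|j ji].
    by rewrite mderivX mnm1E eqxx scale1r -[X in (X - _)%MM]add0m addmK
      mmapX mmap11 mul1r addr0.
  by rewrite mderivX mnm1E eq_sym (negPf ji) scale0r mmap0 mul0r.
elim/mpolyind: q => [|c m q _ _ IH]; first exact: QC.
apply: QD => //; rewrite -mul_mpolyC; apply: (QM) => //.
rewrite mpolyXE_id; apply: big_ind => [|q1 q2|j _]; [exact: QC | exact: QM |].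
elim: (m j) => [|k IHk]; first by rewrite expr0; exact: QC.
by rewrite exprS; apply: QM.
Qed.
End MapMpoly.

(** * Truncated polynomial algebras in characteristic p *)

Section Truncated.
Variables (K : fieldType) (p : nat).
Hypothesis hp : p \in [pchar K].

Definition trunc n (m : 'X_{1..n}) : bool := [forall j, m j < p]%N.

Definition truncated n (q : {mpoly K[n]}) : Prop :=
  forall m, ~~ trunc m -> q@_m = 0.

Definition truncate n (q : {mpoly K[n]}) : {mpoly K[n]} :=
  \sum_(m <- msupp q | trunc m) q@_m *: 'X_[m].

Lemma truncate_truncated n (q : {mpoly K[n]}) : truncated (truncate q).
Proof.
move=> m nm; rewrite raddf_sum /= big1 // => m' tm'.
rewrite mcoeffZ mcoeffX; case: eqP => [mm'|_]; last by rewrite mulr0.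
by rewrite -mm' tm' in nm.
Qed.

Lemma mderiv_truncated n (q : {mpoly K[n]}) i :
  truncated q -> truncated (mderiv i q).
Proof.
move=> tq m nm; rewrite mcoeff_deriv tq ?mul0rn //.
apply: contra nm => /forallP h; apply/forallP => j.
by apply: leq_ltn_trans (h j); rewrite mnmDE leq_addr.
Qed.

(** For truncated [m], the derivative has at [m - U_(i)] the coefficient of [q] at [m] times [m i],
    which is invertible in [K] because [0 < m i < p]. *)
Lemma mderiv0_coef n (q : {mpoly K[n]}) i (m : 'X_{1..n}) :
  truncated q -> mderiv i q = 0 -> (0 < m i)%N -> q@_m = 0.
Proof.
move=> tq dq m0; have [tm|] := boolP (trunc m); last exact: tq.
have := congr1 (mcoeff (m - U_(i))%MM) dq.
rewrite mcoeff0 mcoeff_deriv submK ?lep1mP -?lt0n //.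
rewrite mnmBE mnm1E eqxx subn1 prednK // -mulr_natr => /eqP.
rewrite mulf_eq0 => /orP[/eqP //|].
rewrite -(dvdn_pcharf hp) => /(dvdn_leq m0).
by rewrite leqNgt (forallP tm).
Qed.

Section Kill.
Variables (B : comNzRingType) (g : {rmorphism K -> B}).

Lemma mmap1_nontrunc n (b : 'I_n -> B) m :
  (forall i, b i ^+ p = 0) -> ~~ trunc m -> mmap1 b m = 0.
Proof.
move=> bp; rewrite negb_forall => /existsP[i]; rewrite -leqNgt => pm.
by rewrite /mmap1 (bigD1 i) //= -(subnK pm) exprD bp mulr0 mul0r.
Qed.

Lemma mmap_truncate n (b : 'I_n -> B) q : (forall i, b i ^+ p = 0) ->
  mmap g b (truncate q) = mmap g b q.
Proof.
move=> bp; rewrite {2}/mmap /truncate raddf_sum /=.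
rewrite [RHS](bigID (@trunc n)) /= [X in _ + X]big1 ?addr0.
  by apply: eq_bigr => m _; rewrite mmapZ mmapX.
by move=> m nm; rewrite mmap1_nontrunc ?mulr0.
Qed.

(** Induction on the degree: the derivatives of a truncated [q] in the kernel are again truncated,
    in the kernel and of smaller degree, hence zero. So [q] is constant, and [g] is injective on the
    field [K]. *)
Lemma truncated_eq0 n (b : 'I_n -> B) q :
  (forall q', mmap g b q' = 0 -> forall i, mmap g b (mderiv i q') = 0) ->
  truncated q -> mmap g b q = 0 -> q = 0.
Proof.
move=> dclosed; suff h e (q' : {mpoly K[n]}) :
    (forall m, (e <= mdeg m)%N -> q'@_m = 0) ->
    truncated q' -> mmap g b q' = 0 -> q' = 0.
  by apply: (h (msize q)) => m /msize_mdeg_ge /memN_msupp_eq0.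
elim: e q' => [|e IH] q' hq' tq' q0.
  by apply/mpolyP => m; rewrite hq' // mcoeff0.
have dq i : mderiv i q' = 0.
  apply: IH; [|exact: mderiv_truncated|exact: dclosed].
  by move=> m dm; rewrite mcoeff_deriv hq' ?mul0rn // mdegD mdeg1 addn1.
have qE : q' = (q'@_0)%:MP.
  apply/mpolyP => m; rewrite mcoeffC; case: eqP => [->|/eqP m0].
    by rewrite mulr1.
  rewrite mulr0; have [i mi] : exists i, (0 < m i)%N.
    apply/existsP; rewrite -[X in is_true X]negbK negb_exists; apply: contra m0.
    move=> /forallP h; apply/eqP/mnmP => i; rewrite mnm0E; apply/eqP.
    by rewrite -leqn0 leqNgt.
  exact: (@mderiv0_coef _ _ i).
by move/eqP: q0; rewrite qE mmapC fmorph_eq0 => /eqP ->; rewrite mpolyC0.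
Qed.
End Kill.

Variables (S : comNzRingType) (f : {rmorphism K -> S}).
Variables (aug : {rmorphism S -> K}).
Hypothesis augK : cancel f aug.
Variables (N : nat) (y : 'I_N -> S).
Hypothesis aug_y : forall j, aug (y j) = 0.
Hypothesis y_p : forall j, y j ^+ p = 0.
Hypothesis y_gen : forall s, exists q, mmap f y q = s.

(* The m-th power of the augmentation ideal, generated by the [y j]. *)
Fixpoint augpow (m : nat) (u : S) : Prop :=
  if m is m'.+1 then
    exists2 s : 'I_N -> S, forall j, augpow m' (s j) & u = \sum_j y j * s j
  else True.

Lemma augpowD m u v : augpow m u -> augpow m v -> augpow m (u + v).
Proof.
elim: m u v => [//|m IH] u v [s hs ->] [t ht ->].
exists (fun j => s j + t j) => [j|]; first exact: IH (hs j) (ht j).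
by rewrite -big_split; apply: eq_bigr => j _; rewrite mulrDr.
Qed.

Lemma augpowMl m a u : augpow m u -> augpow m (a * u).
Proof.
elim: m u => [//|m IH] u [s hs ->].
exists (fun j => a * s j) => [j|]; first exact: IH (hs j).
by rewrite mulr_sumr; apply: eq_bigr => j _; rewrite mulrCA.
Qed.

Lemma augpow0 m : augpow m 0.
Proof.
elim: m => [//|m IH]; exists (fun=> 0) => //.
by rewrite big1 // => j _; rewrite mulr0.
Qed.

Lemma augpow_sum m n (g : 'I_n -> S) :
  (forall i, augpow m (g i)) -> augpow m (\sum_i g i).
Proof.
move=> h; apply: (big_ind (augpow m)) => //; first exact: augpow0.
by move=> ? ?; exact: augpowD.
Qed.

Lemma augpowM m l u v : augpow m u -> augpow l v -> augpow (m + l) (u * v).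
Proof.
elim: m u => [|m IH] u; first by move=> _; exact: augpowMl.
move=> [s hs ->] hv; exists (fun j => s j * v) => [j|]; first exact: IH (hs j) hv.
by rewrite mulr_suml; apply: eq_bigr => j _; rewrite mulrA.
Qed.

(** Congruence of [u] to its constant term modulo the ideal of the [y j] passes from constants and
    generators to sums and products, so this ideal is the whole kernel of [aug]. *)
Lemma augpow1 u : aug u = 0 -> augpow 1 u.
Proof.
move=> u0; suff: augpow 1 (u - f (aug u)) by rewrite u0 rmorph0 subr0.
have [q <-] := y_gen u.
apply: (mmap_closed (Q := fun u => augpow 1 (u - f (aug u))))
  => [c|i|a b ha hb|a b ha hb].
- by rewrite augK subrr; exact: augpow0.
- rewrite aug_y rmorph0 subr0; exists (fun j => (j == i)%:R) => //.
  rewrite (bigD1 i) //= eqxx mulr1 big1 ?addr0 // => j /negPf->.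
  by rewrite mulr0.
- by rewrite !rmorphD opprD addrACA; exact: augpowD.
have -> : a * b - f (aug (a * b)) = b * (a - f (aug a)) + f (aug a) * (b - f (aug b)).
  by rewrite !rmorphM !mulrBr addrA [f _ * b]mulrC [b * a]mulrC subrK.
by apply: augpowD; apply: augpowMl.
Qed.

(** A monomial of degree above [N * p] in the [N] elements [y j] has an exponent at least [p], and
    [y j ^+ p = 0]. *)
Lemma augpow_nilp : exists m, forall u, augpow m u -> u = 0.
Proof.
(* The induction trades one power of the ideal for one more factor in the monomial [mu]. *)
suff h m (mu : 'X_{1..N}) u :
    augpow m u -> (N * p < mdeg mu + m)%N -> mmap1 y mu * u = 0.
  exists (N * p).+1 => u hu; rewrite -[u]mul1r -(mmap11 y).
  by apply: h hu _; rewrite mdeg0.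
elim: m mu u => [|m IH] mu u.
  move=> _; rewrite addn0 => hmu; rewrite mmap1_nontrunc ?mul0r //.
  apply: contraL hmu => /forallP h; rewrite -leqNgt mdegE.
  apply: leq_trans (_ : \sum_(j < N) p <= _)%N.
    by apply: leq_sum => j _; exact: ltnW.
  by rewrite sum_nat_const card_ord.
move=> [s hs ->] hmu; rewrite mulr_sumr big1 // => j _.
have := IH (mu + U_(j))%MM (s j) (hs j).
rewrite mdegD mdeg1 addn1 addSnnS => /(_ hmu) <-; rewrite mulrA; congr (_ * _).
rewrite commr_mmap1_M ?mmap1U // => *; exact: mulrC.
Qed.

Variables (n : nat) (w : 'I_n -> S).
Hypothesis aug_w : forall i, aug (w i) = 0.
Hypothesis w_p : forall i, w i ^+ p = 0.
Hypothesis w_span : forall u, aug u = 0 ->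
  exists c : 'I_n -> K, augpow 2 (u - \sum_i f (c i) * w i).

(** The [w i] span the augmentation ideal modulo its square, so their monomials of degree [m] span
    its power [m] modulo the next one. *)
Lemma mmap_approx m u : augpow m u ->
  exists q, augpow m (mmap f w q) /\ augpow m.+1 (u - mmap f w q).
Proof.
have lin v : aug v = 0 ->
    exists q, augpow 1 (mmap f w q) /\ augpow 2 (v - mmap f w q).
  move=> v0; have [c hc] := w_span v0.
  exists (\sum_i c i *: 'X_i).
  have -> : mmap f w (\sum_i c i *: 'X_i) = \sum_i f (c i) * w i.
    by rewrite raddf_sum /=; apply: eq_bigr => i _; rewrite mmapZ mmapXU.
  split=> //; apply: augpow_sum => i; apply: augpowMl.
  exact: augpow1.
elim: m u => [|m IH] u hu.
  exists (aug u)%:MP; split=> //; rewrite mmapC; apply: augpow1.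
  by rewrite rmorphB augK subrr.
have [s hs ->] := hu.
pose qa j := projT1 (cid (lin _ (aug_y j))).
have qaP j := projT2 (cid (lin _ (aug_y j))).
pose qb j := projT1 (cid (IH _ (hs j))).
have qbP j := projT2 (cid (IH _ (hs j))).
exists (\sum_j qa j * qb j).
have -> : mmap f w (\sum_j qa j * qb j) = \sum_j mmap f w (qa j) * mmap f w (qb j).
  by rewrite raddf_sum /=; apply: eq_bigr => j _; rewrite rmorphM.
split.
  apply: augpow_sum => j.
  by apply: (augpowM (m := 1)); [case: (qaP j) | case: (qbP j)].
rewrite -sumrB; apply: augpow_sum => j.
have [a1 a2] := qaP j; have [b1 b2] := qbP j.
set a := mmap f w _ in a1 a2 *; set b := mmap f w _ in b1 b2 *.
(* Both terms lie in the power [m.+2]: [y j - a] is in the square and [s j] in the power [m]; [a] is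
   in the ideal and [s j - b] in the power [m.+1]. *)
have -> : y j * s j - a * b = (y j - a) * s j + a * (s j - b).
  by rewrite mulrBl mulrBr addrA subrK.
by apply: augpowD; [exact: (augpowM (m := 2) a2 (hs j)) | exact: (augpowM (m := 1) a1 b2)].
Qed.

(** Successive approximation, which stops because the augmentation ideal is nilpotent. *)
Lemma mmap_surj u : exists q, mmap f w q = u.
Proof.
have [m hm] := augpow_nilp.
suff [q hq] : exists q, augpow m (u - mmap f w q).
  by exists q; apply/esym/eqP; rewrite -subr_eq0; apply/eqP/hm.
elim: m {hm} => [|m [q hq]]; first by exists 0.
have [q' [_ hq']] := mmap_approx hq.
by exists (q + q'); rewrite rmorphD opprD addrA.
Qed.

Variable D : 'I_n -> S -> S.
Hypothesis D_deriv : forall i, kderiv f (D i).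
Hypothesis D_dual : forall l i, aug (D l (w i)) = (l == i)%:R.

(* The vector of partial derivatives over [T] is killed by a matrix congruent to
   the identity modulo the nilpotent augmentation ideal. *)
Lemma deriv_eq0 (T : pred 'I_n) q :
  (forall l i, T l -> ~~ T i -> D l (w i) = 0) ->
  (forall l, T l -> D l (mmap f w q) = 0) ->
  forall i, T i -> mmap f w (mderiv i q) = 0.
Proof.
move=> DT Dq; pose v i := mmap f w (mderiv i q).
(* The chain rule applied to [D l (mmap f w q) = 0]; the terms with index outside [T] vanish by
   [DT]. *)
have vE l : T l -> v l = \sum_(i | T i) v i * ((l == i)%:R - D l (w i)).
  move=> Tl; under eq_bigr do rewrite mulrBr.
  rewrite sumrB (bigD1 l) //= eqxx mulr1 big1 ?addr0 => [|i /andP[_]]; last first.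
    by rewrite eq_sym => /negPf->; rewrite mulr0.
  suff -> : \sum_(i | T i) v i * D l (w i) = 0 by rewrite subr0.
  rewrite -[RHS](Dq l Tl) (kderiv_mmap _ _ (D_deriv l)) [RHS](bigID T) /=.
  by rewrite [X in _ = _ + X]big1 ?addr0 // => i nTi; rewrite DT ?mulr0.
have vm m : forall l, T l -> augpow m (v l).
  elim: m => [//|m IH] l Tl; rewrite vE //.
  rewrite big_mkcond; apply: augpow_sum => i.
  case: ifP => Ti; last exact: augpow0.
  rewrite -addn1; apply: augpowM; first exact: IH.
  by apply: augpow1; rewrite rmorphB D_dual rmorph_nat subrr.
by have [m hm] := augpow_nilp => i Ti; apply/hm/vm.
Qed.

Lemma mmap_truncated_inj q : truncated q -> mmap f w q = 0 -> q = 0.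
Proof.
apply: truncated_eq0 => q' q0 i; apply: (@deriv_eq0 predT) => // l _.
by rewrite q0; exact: kderiv0 (D_deriv l).
Qed.

(* The truncated polynomial representing [u] involves no variable of [T]. *)
Lemma deriv_kernel (T : pred 'I_n) (Q : S -> Prop) u :
  (forall l i, T l -> ~~ T i -> D l (w i) = 0) ->
  (forall l, T l -> D l u = 0) ->
  (forall c, Q (f c)) -> (forall i, ~~ T i -> Q (w i)) ->
  (forall u v, Q u -> Q v -> Q (u + v)) ->
  (forall u v, Q u -> Q v -> Q (u * v)) -> Q u.
Proof.
have [q0 <-] := mmap_surj u; rewrite -(mmap_truncate _ _ w_p).
set q := truncate q0 => DT Dq Qf Qw QD QM.
have tq : truncated q by exact: truncate_truncated.
have dq i : T i -> mderiv i q = 0.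
  move=> Ti; apply: mmap_truncated_inj; first exact: mderiv_truncated.
  exact: (deriv_eq0 DT Dq).
rewrite /mmap big_seq; apply: big_ind => [||m]; first by rewrite -(rmorph0 f).
  exact: QD.
rewrite mcoeff_msupp => qm; apply: (QM) => //.
apply: big_ind => [||j _]; [by rewrite -(rmorph1 f) | exact: QM |].
have [Tj|nTj] := boolP (T j).
  have [->|m0] := posnP (m j); first by rewrite expr0 -(rmorph1 f).
  by rewrite (mderiv0_coef tq (dq j Tj) m0) eqxx in qm.
elim: (m j) => [|e IH]; first by rewrite expr0 -(rmorph1 f).
by rewrite exprS; apply: QM => //; exact: Qw.
Qed.

(* [S] is the truncated polynomial algebra in the coordinates [w]. *)
Lemma truncated_extend (B : comNzRingType) (g : {rmorphism K -> B})
    (b : 'I_n -> B) :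
  (forall i, b i ^+ p = 0) ->
  exists s : {rmorphism S -> B},
    (forall c, s (f c) = g c) /\ forall i, s (w i) = b i.
Proof.
move=> bp.
(* Since [w] and [b] have zero p-th powers, truncating [q] changes neither value, and a truncated
   polynomial vanishing at [w] is zero. *)
have ker q : mmap f w q = 0 -> mmap g b q = 0.
  rewrite -(mmap_truncate _ _ w_p) -(mmap_truncate _ _ bp).
  by move=> /(mmap_truncated_inj (@truncate_truncated _ q)) ->; rewrite mmap0.
have eqP q q' : mmap f w q = mmap f w q' -> mmap g b q = mmap g b q'.
  move=> /eqP; rewrite -subr_eq0 -mmapB => /eqP/ker/eqP.
  by rewrite mmapB subr_eq0 => /eqP.
pose qq u := projT1 (cid (mmap_surj u)).
have qqP u : mmap f w (qq u) = u := projT2 (cid (mmap_surj u)).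
pose s u := mmap g b (qq u).
have sE q : s (mmap f w q) = mmap g b q by apply: eqP; rewrite qqP.
have sB : zmod_morphism s.
  by move=> u v; rewrite -[u]qqP -[v]qqP -mmapB !sE mmapB.
have sM : monoid_morphism s.
  split; first by rewrite -(rmorph1 (mmap f w)) sE rmorph1.
  by move=> u v; rewrite -[u]qqP -[v]qqP -rmorphM !sE rmorphM.
pose sm : {rmorphism S -> B} := HB.pack s
  (GRing.isZmodMorphism.Build S B s sB) (GRing.isMonoidMorphism.Build S B s sM).
exists sm; split=> [c|i].
  have fE : f c = mmap f w c%:MP by rewrite mmapC.
  by rewrite -[LHS]/(s _) fE sE mmapC.
have wE : w i = mmap f w 'X_i by rewrite mmapXU.
by rewrite -[LHS]/(s _) wE sE mmapXU.
Qed.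

End Truncated.

(** * Functoriality of points, products and actions *)

Section Points.
Variable K : comPzRingType.

Lemma tens_hom_ext (B C : algebra K) (R : comPzRingType)
    (g h : {rmorphism tens_alg B C -> R}) :
  (forall b, g (inla B C b) = h (inla B C b)) ->
  (forall c, g (inra B C c) = h (inra B C c)) -> g =1 h.
Proof.
move=> gb gc t; elim/(@tensA_ind K B C): t => [|t u IHt IHu|b c].
- by rewrite !rmorph0.
- by rewrite !rmorphD /= IHt IHu.
have -> : purea b c = (inla B C b : tens_alg B C) * inra B C c.
  by rewrite /inla /inra pureaM mulr1 mul1r.
by rewrite !rmorphM /= gb gc.
Qed.

Lemma copair_inla (B C R : algebra K) (g : alg_hom B R) (h : alg_hom C R) b :
  copair g h (inla B C b) = g b.
Proof. by rewrite [LHS]copair_pure rmorph1 mulr1. Qed.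

Lemma copair_inra (B C R : algebra K) (g : alg_hom B R) (h : alg_hom C R) c :
  copair g h (inra B C c) = h c.
Proof. by rewrite [LHS]copair_pure rmorph1 mul1r. Qed.

Lemma copair_ext (B C R : algebra K) (g g' : alg_hom B R) (h h' : alg_hom C R) :
  g =1 g' -> h =1 h' -> copair g h =1 copair g' h'.
Proof.
by move=> eg eh; apply: tens_hom_ext => x; rewrite ?copair_inla ?copair_inra.
Qed.

Lemma copair_nat (B C R R' : algebra K) (u : alg_hom R R')
    (g : alg_hom B R) (h : alg_hom C R) t :
  u (copair g h t) = copair (hom_comp u g) (hom_comp u h) t.
Proof.
move: t; apply: (@tens_hom_ext B C R' (hom_map u \o hom_map (copair g h))
    (hom_map (copair (hom_comp u g) (hom_comp u h)))) => x.
  by rewrite -[LHS]/(u (copair g h (inla B C x))) !copair_inla.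
by rewrite -[LHS]/(u (copair g h (inra B C x))) !copair_inra.
Qed.

Variables (H : affine_group K).

Lemma pt_mul_ext (R : algebra K) (g g' h h' : alg_hom H R) :
  g =1 g' -> h =1 h' -> pt_mul g h =1 pt_mul g' h'.
Proof. by move=> eg eh x; exact: copair_ext. Qed.

Lemma pt_mul_nat (R R' : algebra K) (u : alg_hom R R') (g h : alg_hom H R) x :
  u (pt_mul g h x) = pt_mul (hom_comp u g) (hom_comp u h) x.
Proof. exact: copair_nat. Qed.

Variables (X : algebra K) (r : action H X).

Lemma act_ext (R : algebra K) (g g' : alg_hom H R) (x x' : alg_hom X R) :
  g =1 g' -> x =1 x' -> act r g x =1 act r g' x'.
Proof. by move=> eg ex y; exact: copair_ext. Qed.

Lemma act_nat (R R' : algebra K) (u : alg_hom R R') (g : alg_hom H R)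
    (x : alg_hom X R) y :
  u (act r g x y) = act r (hom_comp u g) (hom_comp u x) y.
Proof. exact: copair_nat. Qed.
End Points.

(** * Functoriality of the dual numbers *)

Section DualMap.
Variables (B C : comPzRingType) (u : {rmorphism B -> C}).

Definition dual_map_fun (x : dual_ring B) : dual_ring C := (u x.1, u x.2).
Fact dual_map_zmod : zmod_morphism dual_map_fun.
Proof. by move=> x y; rewrite /dual_map_fun !rmorphB. Qed.
Fact dual_map_monoid : monoid_morphism dual_map_fun.
Proof.
split=> [|x y]; first by rewrite /dual_map_fun rmorph0 rmorph1.
rewrite /dual_map_fun -[RHS]/(dual_mul _ _) /dual_mul /=.
by rewrite rmorphM rmorphD !rmorphM.
Qed.
Definition dual_map : {rmorphism dual_ring B -> dual_ring C} :=
  HB.pack dual_map_fun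
    (GRing.isZmodMorphism.Build (dual_ring B) (dual_ring C) _ dual_map_zmod)
    (GRing.isMonoidMorphism.Build (dual_ring B) (dual_ring C) _ dual_map_monoid).
Lemma dual_mapE x : dual_map x = (u x.1, u x.2).
Proof. by []. Qed.
End DualMap.

Section DualFst.
Variable C : comPzRingType.

Definition dual_fst_fun (x : dual_ring C) : C := x.1.
Fact dual_fst_zmod : zmod_morphism dual_fst_fun.
Proof. by []. Qed.
Fact dual_fst_monoid : monoid_morphism dual_fst_fun.
Proof. by []. Qed.
Definition dual_fst : {rmorphism dual_ring C -> C} :=
  HB.pack dual_fst_fun
    (GRing.isZmodMorphism.Build (dual_ring C) C _ dual_fst_zmod)
    (GRing.isMonoidMorphism.Build (dual_ring C) C _ dual_fst_monoid).
End DualFst.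

Lemma dual_fst_alg (K : comPzRingType) (B : algebra K) (c : K) :
  dual_fst B (alg_map (dual B) c) = alg_map B c.
Proof. by []. Qed.
Definition dual_fst_hom (K : comPzRingType) (B : algebra K) :
  alg_hom (dual B) B := @AlgHom K (dual B) B (dual_fst B) (@dual_fst_alg K B).

(** * The coordinate ring of H_F and its invariant derivations *)

Section Coordinates.
Variables (k F : fieldType) (i : {rmorphism k -> F}) (H : affine_group k).

(** The counit of H_F, that is, evaluation at the origin. *)
Definition aug_hom : alg_hom (tens_alg H (Fk i)) (Fk i) :=
  copair (hom_comp (hom_str (Fk i)) (counit H)) (hom_id (Fk i)).

(* The coordinate ring of H_F. *)
Definition coordF : Type := tensA H (Fk i).
HB.instance Definition _ := GRing.ComPzRing.on coordF.
Fact coordF_nz : (1 : coordF) != 0.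
Proof.
apply/eqP => /(congr1 aug_hom) /eqP.
by rewrite rmorph0 [X in X == _]rmorph1 oner_eq0.
Qed.
HB.instance Definition _ :=
  GRing.PzSemiRing_isNonZero.Build coordF coordF_nz.

Definition aug : {rmorphism coordF -> F} := hom_map aug_hom.
Definition scal : {rmorphism F -> coordF} :=
  (inra H (Fk i) : {rmorphism Fk i -> tensA H (Fk i)}).
Definition gen : {rmorphism H -> coordF} :=
  (inla H (Fk i) : {rmorphism H -> tensA H (Fk i)}).
Definition coordFA : algebra F := @Algebra F coordF scal.

Lemma aug_scal : cancel scal aug.
Proof. by move=> c; rewrite [LHS]copair_inra. Qed.

Lemma aug_gen a : aug (gen a) = i (counit H a).
Proof. by rewrite [LHS]copair_inla. Qed.

Lemma gen_alg (c : k) : gen (alg_map H c) = scal (i c).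
Proof. exact: (inla_inra H (Fk i)). Qed.

Lemma coordF_ind (Q : coordF -> Prop) :
  (forall c, Q (scal c)) -> (forall a, Q (gen a)) ->
  (forall u v, Q u -> Q v -> Q (u + v)) ->
  (forall u v, Q u -> Q v -> Q (u * v)) -> forall u, Q u.
Proof.
move=> Qc Qg QD QM; apply: (@tensA_ind k H (Fk i)) => [|//|b c].
  by rewrite -(rmorph0 scal).
have -> : purea b c = gen b * scal c :> coordF.
  by rewrite [RHS]pureaM mulr1 mul1r.
exact: QM.
Qed.

(** The universal point of H_F, corresponding to the identity of its coordinate ring. *)
Definition generic : alg_hom H (restr i coordFA) :=
  @AlgHom _ H (restr i coordFA) gen gen_alg.

Definition scal_dual (C : algebra F) : alg_hom (Fk i) (restr i (dual C)) :=
  hom_restr i (hom_str (dual C)).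

Definition generic_dual_map : {rmorphism H -> dual_ring coordF} :=
  @dual_cst coordF \o gen.
Lemma generic_dual_alg (c : k) :
  generic_dual_map (alg_map H c) = alg_map (restr i (dual coordFA)) c.
Proof. by rewrite /= gen_alg. Qed.
Definition generic_dual : alg_hom H (restr i (dual coordFA)) :=
  @AlgHom k H (restr i (dual coordFA)) generic_dual_map generic_dual_alg.

Lemma scal_dual_alg (c : F) :
  dual_map scal (alg_map (dual (base F)) c) = alg_map (dual coordFA) c.
Proof. by rewrite dual_mapE /= rmorph0. Qed.
Definition dual_scal_hom : alg_hom (dual (base F)) (dual coordFA) :=
  @AlgHom F (dual (base F)) (dual coordFA) (dual_map scal) scal_dual_alg.

Lemma aug_dual_alg (c : F) :
  dual_map aug (alg_map (dual coordFA) c) = alg_map (dual (base F)) c.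
Proof. by rewrite dual_mapE /= aug_scal rmorph0. Qed.
Definition dual_aug_hom : alg_hom (dual coordFA) (dual (base F)) :=
  @AlgHom F (dual coordFA) (dual (base F)) (dual_map aug) aug_dual_alg.

Definition tpoint (n : pder H (Fk i)) : alg_hom H (restr i (dual (base F))) :=
  @pder_point k F i H (base F) n.

Definition tpointF (n : pder H (Fk i)) : alg_hom H (restr i (dual coordFA)) :=
  hom_comp (hom_restr i dual_scal_hom) (tpoint n).

Section DerivationOfPoint.
Variable G : alg_hom H (restr i (dual coordFA)).

Definition point_eval : alg_hom (tens_alg H (Fk i)) (restr i (dual coordFA)) :=
  copair G (scal_dual coordFA).
(** When [G] lifts the generic point, it acts on the coordinate ring as u -> u + D(u) e; this is
    D. *)
Definition point_deriv (u : coordF) : coordF := (point_eval u).2.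

Hypothesis G1 : forall a, (G a).1 = gen a.

Lemma point_eval1 u : (point_eval u).1 = u.
Proof.
elim/coordF_ind: u => [c|a|u v hu hv|u v hu hv].
- by rewrite [point_eval _]copair_inra.
- by rewrite [point_eval _]copair_inla G1.
- by rewrite rmorphD /= hu hv.
- by rewrite rmorphM /= hu hv.
Qed.

Lemma point_deriv_kderiv : kderiv scal point_deriv.
Proof.
split=> [u v|u v|c]; rewrite /point_deriv.
- by rewrite rmorphD.
- by rewrite rmorphM [LHS]/= !point_eval1.
- by rewrite [point_eval _]copair_inra.
Qed.
End DerivationOfPoint.

(* The F-linear extension of [n] to the coordinate ring of H_F. *)
Definition pderF (n : pder H (Fk i)) (u : coordF) : F :=
  (copair (tpoint n) (scal_dual (base F)) u).2.

Lemma pderF_gen n a : pderF n (gen a) = n a.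
Proof. by rewrite /pderF [copair _ _ _]copair_inla. Qed.

Lemma pderF_scal n c : pderF n (scal c) = 0.
Proof. by rewrite /pderF [copair _ _ _]copair_inra. Qed.

Lemma pderFD n u v : pderF n (u + v) = pderF n u + pderF n v.
Proof. by rewrite /pderF rmorphD. Qed.

Lemma pderF1 n u : (copair (tpoint n) (scal_dual (base F)) u).1 = aug u.
Proof.
elim/coordF_ind: u => [c|a|u v hu hv|u v hu hv].
- by rewrite [copair _ _ _]copair_inra aug_scal.
- by rewrite [copair _ _ _]copair_inla aug_gen.
- by rewrite !rmorphD /= hu hv.
- by rewrite !rmorphM /= hu hv.
Qed.

Lemma pderFM n u v : pderF n (u * v) = aug u * pderF n v + pderF n u * aug v.
Proof. by rewrite /pderF rmorphM [LHS]/= !pderF1. Qed.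

(** By naturality of [copair], evaluating the derivation at the origin amounts to specializing [G]
    along [aug]. *)
Lemma aug_point_deriv n (G : alg_hom H (restr i (dual coordFA))) u :
  (forall a, dual_aug_hom (G a) = tpoint n a) ->
  aug (point_deriv G u) = pderF n u.
Proof.
move=> hG; rewrite -[LHS]/(dual_aug_hom (point_eval G u)).2.
rewrite [X in X.2](copair_nat (hom_restr i dual_aug_hom)).
congr (_.2).
apply: (@copair_ext k H (Fk i) (restr i (dual (base F)))) => [a|c]; first exact: hG.
by rewrite -[LHS]/(dual_aug_hom _) [LHS]aug_dual_alg.
Qed.

(* The generic point translated by a tangent vector, from the right or from the
   left; the associated derivations are the invariant ones. *)
Definition rpoint n := pt_mul generic_dual (tpointF n).
Definition lpoint n := pt_mul (tpointF n) generic_dual.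

Lemma generic_dual_aug a :
  hom_comp (hom_restr i dual_aug_hom) generic_dual a = pt_one (restr i (dual (base F))) a.
Proof.
rewrite -[LHS]/(dual_map aug (dual_cst (gen a))) dual_mapE /= aug_gen rmorph0.
by [].
Qed.

Lemma tpointF_aug n a :
  hom_comp (hom_restr i dual_aug_hom) (tpointF n) a = tpoint n a.
Proof.
rewrite -[LHS]/(dual_map aug (dual_map scal (tpoint n a))) !dual_mapE !aug_scal.
by case: (tpoint n a).
Qed.

(** At the origin the generic point becomes the neutral element, so only the tangent vector is
    left. *)
Lemma rpoint_aug n a : dual_aug_hom (rpoint n a) = tpoint n a.
Proof.
rewrite [LHS](pt_mul_nat (hom_restr i dual_aug_hom)) -[RHS]pt_mul1.
by apply: (@pt_mul_ext k H (restr i (dual (base F)))) => b;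
  [exact: generic_dual_aug | exact: tpointF_aug].
Qed.

Lemma lpoint_aug n a : dual_aug_hom (lpoint n a) = tpoint n a.
Proof.
rewrite [LHS](pt_mul_nat (hom_restr i dual_aug_hom)) -[RHS]pt_mulr1.
by apply: (@pt_mul_ext k H (restr i (dual (base F)))) => b;
  [exact: tpointF_aug | exact: generic_dual_aug].
Qed.

(** The constant part of [tpointF n] is the neutral element. This makes [point_deriv (rpoint n)] a
    derivation. *)
Lemma rpoint1 n a : (rpoint n a).1 = gen a.
Proof.
rewrite -[LHS]/(dual_fst_hom coordFA (rpoint n a)).
rewrite [LHS](pt_mul_nat (hom_restr i (dual_fst_hom coordFA))).
rewrite -[RHS](pt_mulr1 (generic : alg_hom H (restr i coordFA)) a).
by apply: (@pt_mul_ext k H (restr i coordFA)) => b.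
Qed.

Lemma lpoint1 n a : (lpoint n a).1 = gen a.
Proof.
rewrite -[LHS]/(dual_fst_hom coordFA (lpoint n a)).
rewrite [LHS](pt_mul_nat (hom_restr i (dual_fst_hom coordFA))).
rewrite -[RHS](pt_mul1 (generic : alg_hom H (restr i coordFA)) a).
by apply: (@pt_mul_ext k H (restr i coordFA)) => b.
Qed.
End Coordinates.

(** * The coaction and the vector fields on Spec F *)

Section Coaction.
Variables (k F : fieldType) (i : {rmorphism k -> F}) (H : affine_group k).
Variable r : action H (Fk i).
Local Notation scal := (scal i H).
Local Notation gen := (gen i H).
Local Notation aug := (aug i H).
Local Notation pderF := (@pderF k F i H).

Definition rho : {rmorphism F -> coordF i H} := hom_map (coact r).

Lemma aug_rho y : aug (rho y) = y.
Proof. exact: (act_one r (hom_id (Fk i)) y). Qed.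

Lemma vf_pderF d y : vf r d y = pderF (lift_pder i d 1) (rho y).
Proof. by []. Qed.

Lemma generic_dual_rho y :
  act r (generic_dual i H) (scal_dual i (coordFA i H)) y = (rho y, 0).
Proof.
suff h u : copair (generic_dual i H) (scal_dual i (coordFA i H)) u = (u, 0) by exact: h.
elim/coordF_ind: u => [c|a|u v hu hv|u v hu hv].
- by rewrite [LHS]copair_inra.
- by rewrite [LHS]copair_inla.
- by rewrite rmorphD hu hv -[RHS]/(_, _); congr pair; rewrite addr0.
by rewrite rmorphM hu hv [LHS]/(dual_mul _ _) /dual_mul /= mulr0 mul0r addr0.
Qed.

Section Tangent.
Variable n : pder H (Fk i).

Definition tangent : alg_hom (Fk i) (restr i (dual (coordFA i H))) :=
  act r (tpointF n) (scal_dual i (coordFA i H)).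

(** The point [tangent] comes from one with values in F[e] by extending scalars along [scal]; its
    constant part is the identity because the neutral element acts trivially. *)
Lemma tangentE y : tangent y = (scal y, scal (pderF n (rho y))).
Proof.
transitivity (dual_scal_hom i H (act r (tpoint n) (scal_dual i (base F)) y)).
  rewrite [RHS](act_nat r (hom_restr i (dual_scal_hom i H))).
  apply: (@act_ext k H (Fk i) r (restr i (dual (coordFA i H)))) => // c.
  by rewrite -[RHS]/(dual_map scal (alg_map (dual (base F)) c)) [RHS]scal_dual_alg.
rewrite -[LHS]/(dual_map scal _) dual_mapE; congr (scal _, _).
by rewrite -[RHS]aug_rho -(pderF1 n).
Qed.

Definition rtangent : alg_hom (tens_alg H (Fk i)) (restr i (dual (coordFA i H))) :=
  copair (generic_dual i H) tangent.

Lemma rtangent1 u : (rtangent u).1 = u.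
Proof.
elim/coordF_ind: u => [c|a|u v hu hv|u v hu hv].
- by rewrite [rtangent _]copair_inra [tangent _]tangentE.
- by rewrite [rtangent _]copair_inla.
- by rewrite rmorphD /= hu hv.
- by rewrite rmorphM /= hu hv.
Qed.

(** Associativity of the action: the product acts by the tangent vector first, then by the generic
    point. *)
Lemma rpoint_rho y : point_eval (rpoint n) (rho y) = rtangent (rho y).
Proof.
exact: (act_mul r (generic_dual i H) (tpointF n) (scal_dual i (coordFA i H)) y).
Qed.

(** If the vector field of [n] is zero, [tangent] is the constant point, and the translated generic
    point moves it exactly as the generic point does. *)
Lemma rpoint_inert y : (forall x, pderF n (rho x) = 0) ->
  point_deriv (rpoint n) (rho y) = 0.
Proof.
move=> n0; rewrite /point_deriv rpoint_rho.
have e c : tangent c = scal_dual i (coordFA i H) c.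
  by rewrite tangentE n0 rmorph0.
have h := @copair_ext k H (Fk i) (restr i (dual (coordFA i H)))
  (generic_dual i H) (generic_dual i H) _ _ (fun _ => erefl) e (rho y).
by rewrite [rtangent _]h [X in X.2](generic_dual_rho y).
Qed.

(* The derivation [1 (x) v], for [v] the vector field of [n], corrected by a
   left-invariant derivation so as to kill the image of [rho]. *)
Definition rho_deriv (u : coordF i H) : coordF i H :=
  (rtangent u).2 - point_deriv (rpoint n) u.

Lemma rho_derivD u v : rho_deriv (u + v) = rho_deriv u + rho_deriv v.
Proof.
have [hD _ _] := point_deriv_kderiv (rpoint1 n).
by rewrite /rho_deriv rmorphD hD opprD addrACA.
Qed.

Lemma rho_derivM u v : rho_deriv (u * v) = u * rho_deriv v + rho_deriv u * v.
Proof.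
have [_ hM _] := point_deriv_kderiv (rpoint1 n).
rewrite /rho_deriv rmorphM hM [X in X - _]/= !rtangent1.
by rewrite mulrBr mulrBl opprD addrACA.
Qed.

Lemma rho_deriv_rho y : rho_deriv (rho y) = 0.
Proof. by rewrite /rho_deriv /point_deriv rpoint_rho subrr. Qed.

Lemma rho_deriv_scal c : rho_deriv (scal c) = scal (pderF n (rho c)).
Proof.
have [_ _ hc] := point_deriv_kderiv (rpoint1 n).
by rewrite /rho_deriv hc subr0 [rtangent _]copair_inra [tangent _]tangentE.
Qed.
End Tangent.

(** Here the generic point acts first, so [rho] intertwines the vector field with the
    right-invariant derivation. The values of [d] lie in [k], where [rho] and [scal] agree; a
    tangent vector with values in [F] need not have this property. *)
Lemma lpoint_rho d y :
  point_deriv (lpoint (lift_pder i d 1)) (rho y) = rho (vf r d y).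
Proof.
set n := lift_pder i d 1.
rewrite -[LHS]/(act r (lpoint n) (scal_dual i (coordFA i H)) y).2.
rewrite [X in X.2](act_mul r).
have rho_alg c : dual_map rho (alg_map (restr i (dual (base F))) c) =
    alg_map (restr i (dual (coordFA i H))) c.
  by rewrite dual_mapE /= rmorph0 [rho _](hom_alg (coact r)) [_ c]gen_alg.
pose u := @AlgHom k (restr i (dual (base F))) (restr i (dual (coordFA i H)))
  (dual_map rho) rho_alg.
rewrite -[RHS]/((u (vf_point r d y)).2).
rewrite [u _](act_nat r); congr (_.2).
apply: (@act_ext k H (Fk i) r (restr i (dual (coordFA i H)))) => [a|c].
  rewrite -[RHS]/(dual_map rho (tpoint n a)) -[LHS]/(dual_map scal (tpoint n a)).
  rewrite !dual_mapE /= /pder_point_fun /= /lift_pder_fun /= mul1r.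
  by rewrite !(hom_alg (coact r)) -!gen_alg.
by rewrite [LHS]generic_dual_rho -[RHS]/(dual_map rho _) dual_mapE /= rmorph0.
Qed.
End Coaction.

(** * Finite codimension and separating points *)

Section LinearAlgebra.
Variable K : fieldType.

(** A generating family of minimal size modulo [W] is a basis: a nontrivial relation would allow one
    member to be dropped. *)
Lemma has_codim_finite (V : lmodType K) (W : V -> Prop) (N : nat) (v : 'I_N -> V) :
  (forall u u' c, W u -> W u' -> W (u + c *: u')) ->
  (forall u, exists a : 'I_N -> K, W (u - \sum_j a j *: v j)) ->
  exists n, has_codim W n.
Proof.
move=> WD span.
pose P n := `[< exists b : 'I_n -> V,
  forall u, exists a : 'I_n -> K, W (u - \sum_j a j *: b j) >].
have exP : exists n, P n by exists N; apply/asboolP; exists v.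
case: (ex_minnP exP) => n /asboolP[b hb] nmin.
have indep (e : 'I_n -> K) : W (\sum_l e l *: b l) -> forall j, e j = 0.
  move=> We j; apply/eqP/negPn/negP => ej.
  case: n b hb nmin e We j ej => [|n] b hb nmin e We j ej; first by case: j {ej}.
  suff /nmin : P n by rewrite ltnn.
  apply/asboolP; exists (fun l => b (lift j l)) => u; have [a ha] := hb u.
  exists (fun l => a (lift j l) - a j / e j * e (lift j l)).
  have := WD _ _ (a j / e j) ha We.
  rewrite !(bigD1_ord j) //= scalerDr scalerA divfK // opprD.
  rewrite -addrA [- _ - _]addrC -!addrA [- (a j *: _) + _]addrA addNr add0r.
  congr (W (_ + _)); rewrite scaler_sumr -sumrN -sumrN -big_split.
  apply: eq_bigr => l _ /=.
  by rewrite scalerBl opprB scalerA addrC.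
exists n, b => u; have [a ha] := hb u.
exists (\row_j a j); split; first by under eq_bigr do rewrite mxE.
move=> a' ha'; apply/rowP => j; rewrite mxE; apply/eqP.
rewrite eq_sym -subr_eq0; apply/eqP; apply: (indep (fun l => a' 0 l - a l)).
have := WD _ _ (-1) ha ha'; rewrite scaleN1r opprB addrC addrA subrK.
by rewrite -sumrB; under eq_bigr do rewrite -scalerBl.
Qed.

(** Take as many points as possible with independent evaluation rows; at most [n] are possible. *)
Lemma row_free_points (T : Type) n (f : 'I_n -> T -> K) :
  exists c (y : 'I_c -> T), row_free (\matrix_(j < c, l < n) f l (y j)) /\
    forall a : 'I_n -> K, (forall j, \sum_l a l * f l (y j) = 0) ->
    forall t, \sum_l a l * f l t = 0.
Proof.
pose M c (y : 'I_c -> T) := \matrix_(j < c, l < n) f l (y j).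
pose P c := `[< exists y : 'I_c -> T, row_free (M c y) >].
have exP : exists c, P c.
  have y0 : 'I_0 -> T by case.
  by exists 0%N; apply/asboolP; exists y0; rewrite /row_free -leqn0 rank_leq_row.
have boundP c : P c -> (c <= n)%N.
  by move=> /asboolP[y /eqP <-]; exact: rank_leq_col.
case: (ex_maxnP exP boundP) => c /asboolP[y fy] cmax.
exists c, y; split=> // a ha t; apply/eqP/negPn/negP => at0.
(* A combination [a] that vanishes at all [y j] but not at [t] makes the evaluation at [t]
   independent of the others. *)
suff : P (c + 1)%N by move=> /cmax; rewrite addn1 ltnn.
apply/asboolP; exists (fun j : 'I_(c + 1) =>
  if fintype.split j is inl j' then y j' else t).
set M' := M _ _.
have -> : M' = col_mx (M c y) (\row_l f l t).
  apply/matrixP => j l; rewrite !mxE.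
  by case: (fintype.split j) => j'; rewrite mxE.
apply: inj_row_free => u; rewrite -[u]hsubmxK mul_row_col => u0.
pose A := (\col_l a l : 'cV[K]_n).
have MA : M c y *m A = 0.
  apply/colP => j; rewrite !mxE -[RHS](ha j); apply: eq_bigr => l _.
  by rewrite !mxE mulrC.
have rA : (\row_l f l t) *m A = (\sum_l a l * f l t)%:M.
  apply/rowP => j; rewrite !mxE ord1 eqxx mulr1n; apply: eq_bigr => l _.
  by rewrite !mxE mulrC.
have u2 : rsubmx u = 0.
  have := congr1 (mulmx^~ A) u0.
  rewrite mulmxDl -!mulmxA MA mulmx0 add0r rA mul0mx mul_mx_scalar => /eqP.
  by rewrite scaler_eq0 (negPf at0) => /eqP.
move: u0; rewrite u2 mul0mx addr0 => /eqP.
by rewrite mulmx_free_eq0 // => /eqP ->; rewrite row_mx0.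
Qed.

Lemma row_free_complete c n (M : 'M[K]_(c, n)) : row_free M ->
  exists (g : 'M[K]_n) (j : 'I_c -> 'I_n),
    [/\ injective j, g \in unitmx & forall l m, g (j l) m = M l m].
Proof.
move=> fM; have cn : (c <= n)%N by rewrite -(eqP fM) rank_leq_col.
pose U : 'M[K]_(c, n) := pid_mx c; pose V : 'M[K]_(n, c) := pid_mx c.
have UV : U *m (V *m M) = M.
  by rewrite mulmxA mul_pid_mx minnn (minn_idPr cn) pid_mx_1 mul1mx.
have [|g gu Ug] := @complete_unitmx _ _ _ U (V *m M).
  by rewrite UV (eqP fM) rank_pid_mx.
exists g, (widen_ord cn); split=> [x x' /(congr1 val) /= /val_inj //|//|l m].
rewrite -UV Ug mxE (bigD1 (widen_ord cn l)) //= mxE /= eqxx ltn_ord mul1r.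
rewrite big1 ?addr0 // => l' ne; rewrite mxE.
by case: eqP => [e|_]; [rewrite -val_eqE /= e eqxx in ne | rewrite mul0r].
Qed.
End LinearAlgebra.

(** * A basis of Lie(H) and dual coordinates *)

Section LieBasis.
Variables (k : fieldType) (H : affine_group k).
Local Notation eps := (counit H).
Local Notation alg := (alg_map H).

(** The square of the augmentation ideal. Sums of products suffice, since a scalar is absorbed into
    a factor. *)
Inductive aug_sq : H -> Prop :=
| aug_sq0 : aug_sq 0
| aug_sqD a b : aug_sq a -> aug_sq b -> aug_sq (a + b)
| aug_sqM a b : eps a = 0 -> eps b = 0 -> aug_sq (a * b).

Lemma eps_alg (c : k) : eps (alg c) = c.
Proof. exact: (hom_alg eps c). Qed.

Lemma aug_sqZ (c : k) a : aug_sq a -> aug_sq (alg c * a).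
Proof.
elim=> [|a' b' _ ha _ hb|a' b' ha hb]; first by rewrite mulr0; exact: aug_sq0.
  by rewrite mulrDr; exact: aug_sqD.
by rewrite mulrA; apply: aug_sqM; rewrite // rmorphM ha mulr0.
Qed.

(* Congruence modulo constants and the square of the augmentation ideal. *)
Definition infinitesimal (a : asmod H) : Prop := aug_sq ((a : H) - alg (eps a)).

Lemma infinitesimalD (a b : asmod H) :
  infinitesimal a -> infinitesimal b -> infinitesimal (a + b).
Proof.
move=> ha hb; rewrite /infinitesimal !rmorphD opprD addrACA.
exact: aug_sqD.
Qed.

Lemma infinitesimalZ (c : k) (a : asmod H) :
  infinitesimal a -> infinitesimal (c *: a).
Proof.
move=> ha; rewrite /infinitesimal -[c *: a]/(alg c * (a : H)).
by rewrite !rmorphM eps_alg -mulrBr; exact: aug_sqZ.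
Qed.

Lemma infinitesimal_alg (c : k) : infinitesimal (alg c).
Proof. by rewrite /infinitesimal eps_alg subrr; exact: aug_sq0. Qed.

Lemma infinitesimal_leibniz (a b : H) :
  infinitesimal (a * b - alg (eps a) * b - alg (eps b) * a).
Proof.
rewrite /infinitesimal !rmorphB !rmorphM !eps_alg.
have -> : a * b - alg (eps a) * b - alg (eps b) * a -
    (alg (eps a) * alg (eps b) - alg (eps a) * alg (eps b) -
     alg (eps b) * alg (eps a)) = (a - alg (eps a)) * (b - alg (eps b)) by ring.
by apply: aug_sqM; rewrite rmorphB eps_alg subrr.
Qed.

(** Lie(H) is dual to the coordinate ring modulo constants and the square of the augmentation ideal.
    This quotient is finite dimensional because the algebra is finitely generated, and its
    coordinate functions are point derivations. *)
Lemma lie_basis : finite_type H ->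
  exists n (x : 'I_n -> H) (d : 'I_n -> lie H),
    [/\ forall l, eps (x l) = 0, forall l m, d l (x m) = (l == m)%:R &
        forall a, aug_sq (a - alg (eps a) - \sum_l alg (d l a) * x l)].
Proof.
move=> [N [x xgen]].
pose W := infinitesimal.
have WD u u' c : W u -> W u' -> W (u + c *: u').
  by move=> hu hu'; apply/infinitesimalD/infinitesimalZ.
pose Q (u : asmod H) := exists a : 'I_N -> k, W (u - \sum_j a j *: (x j : asmod H)).
have QD (u v : H) : Q u -> Q v -> Q (u + v).
  move=> [a ha] [b hb]; exists (fun j => a j + b j).
  under eq_bigr do rewrite scalerDl.
  by rewrite big_split opprD addrACA; exact: infinitesimalD.
have QZ (c : k) (u : H) : Q u -> Q (alg c * u).
  move=> [a ha]; exists (fun j => c * a j).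
  have := infinitesimalZ c ha; rewrite scalerBr scaler_sumr.
  by under eq_bigr do rewrite scalerA.
have QW (u : H) : W u -> Q u.
  move=> hu; exists (fun=> 0); rewrite big1 ?subr0 // => j _.
  by rewrite scale0r.
(* Modulo [W] a product is a combination of its two factors, so the span of the generators is closed
   under products. *)
have QM (u v : H) : Q u -> Q v -> Q (u * v).
  move=> hu hv.
  have -> : u * v = (u * v - alg (eps u) * v - alg (eps v) * u) +
      (alg (eps v) * u + alg (eps u) * v) by rewrite addrA subrK subrK.
  apply: (QD); first exact/QW/infinitesimal_leibniz.
  by apply: (QD); exact: QZ.
have Q1 : Q 1 by rewrite -(rmorph1 alg); exact/QW/infinitesimal_alg.
have span (u : asmod H) : Q u.
  have [q ->] := xgen u.
  apply: (big_ind Q) => [||m _].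
  - by rewrite -(rmorph0 alg); exact/QW/infinitesimal_alg.
  - exact: QD.
  apply: QZ; apply: (big_ind Q) => [//||j _]; first exact: QM.
  elim: (m j) => [|e IH]; first by rewrite expr0.
  rewrite exprS; apply: QM => //; exists (fun l => (l == j)%:R).
  rewrite (bigD1 j) //= eqxx scale1r big1 ?addr0 ?subrr => [|l /negPf ->].
    by rewrite -[0](rmorph0 alg); exact: infinitesimal_alg.
  by rewrite scale0r.
have [n [b hb]] := has_codim_finite WD span.
pose c u := projT1 (cid (hb u)).
have cP u : W (u - \sum_j c u 0 j *: b j) by case: (projT2 (cid (hb u))).
have cE u a : W (u - \sum_j a j *: b j) -> forall j, c u 0 j = a j.
  move=> ha j; have [_ h] := projT2 (cid (hb u)).
  have := h (\row_j a j); rewrite -/(c u) => -> ; first by rewrite mxE.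
  by under eq_bigr do rewrite mxE.
have c0 u : W u -> forall j, c u 0 j = 0.
  move=> hu; apply: cE; rewrite big1 ?subr0 // => j _; exact: scale0r.
have cD u v j : c (u + v) 0 j = c u 0 j + c v 0 j.
  move: j; apply: cE; under eq_bigr do rewrite scalerDl.
  by rewrite big_split opprD addrACA; exact: infinitesimalD (cP u) (cP v).
have cZ e u j : c (e *: u) 0 j = e * c u 0 j.
  move: j; apply: cE; have := infinitesimalZ e (cP u).
  by rewrite scalerBr scaler_sumr; under eq_bigr do rewrite scalerA.
have cB u v j : c (u - v) 0 j = c u 0 j - c v 0 j.
  by rewrite -[- v]scaleN1r cD cZ mulN1r.
(* Coordinates vanish on [W], so the congruence of [infinitesimal_leibniz] becomes the Leibniz
   rule. *)
have dP j : is_pder (C := base k) (fun u : H => c u 0 j : asmod (base k)).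
  apply/asboolP; split=> [u v|e|u v]; first exact: cD.
    exact/c0/infinitesimal_alg.
  have := c0 _ (infinitesimal_leibniz u v) j.
  rewrite -[X in c X]/((u * v : asmod H) - eps u *: (v : asmod H)
    - eps v *: (u : asmod H)).
  by rewrite !cB !cZ => /eqP; rewrite -addrA -opprD subr_eq0 => /eqP.
pose d j : lie H := Pder (dP j).
have bE l m : c (b m) 0 l = (l == m)%:R.
  move: l; apply: cE.
  rewrite (bigD1 m) //= eqxx scale1r big1 ?addr0 ?subrr => [|l /negPf ->].
    by rewrite -[0](rmorph0 alg); exact: infinitesimal_alg.
  by rewrite scale0r.
(* Subtracting constants moves the basis into the augmentation ideal without changing its classes
   modulo [W]. *)
exists n, (fun l => (b l : H) - alg (eps (b l))), d; split=> [l|l m|a].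
- by rewrite rmorphB eps_alg subrr.
- rewrite -[LHS]/(c (b m - (alg (eps (b m)) : asmod H)) 0 l) cB bE.
  by rewrite (c0 _ (infinitesimal_alg _)) subr0.
have := cP a; set s := \sum_j _; rewrite /W /infinitesimal.
have -> : \sum_l alg (d l a) * ((b l : H) - alg (eps (b l))) = (s : H) - alg (eps s).
  rewrite !rmorph_sum /= -sumrB; apply: eq_bigr => l _.
  by rewrite mulrBr !rmorphM eps_alg.
have e (u v : H) : u - v - alg (eps (u - v)) = u - alg (eps u) - (v - alg (eps v)).
  by rewrite !rmorphB; ring.
by rewrite -e.
Qed.
End LieBasis.

(** * The Lie algebra of H_F and its map to the derivations of F *)

Section LieF.
Variables (k F : fieldType) (i : {rmorphism k -> F}) (H : affine_group k).
Local Notation pderF := (@pderF k F i H).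

Lemma pderF_lin (n n1 n2 : pder H (Fk i)) (c : F) u :
  (forall a, n a = n1 a + (c : asmod (Fk i)) * n2 a) ->
  pderF n u = pderF n1 u + c * pderF n2 u.
Proof.
move=> e; elim/coordF_ind: u => [x|a|u v hu hv|u v hu hv].
- by rewrite !pderF_scal mulr0 addr0.
- by rewrite !pderF_gen e.
- by rewrite !pderFD hu hv mulrDr addrACA.
by rewrite !pderFM hu hv; ring.
Qed.

Lemma lift_pder_balanced :
  balanced (fun (d : lie H) (l : asmod (Fk i)) => lift_pder i d (l : F)).
Proof.
split=> [d e m|d m n|c d m]; apply: val_inj; apply/funext => a /=.
- by rewrite /lift_pder_fun -[(d + e) a]/(d a + e a) rmorphD mulrDr.
- by rewrite /lift_pder_fun mulrDl.
rewrite /lift_pder_fun -[(c *: d) a]/((c : k) * d a) rmorphM.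
by rewrite -[c *: m]/(i c * (m : F)) mulrA [m * _]mulrC.
Qed.

Lemma lieF_pderD (t u : lieF i H) : lieF_pder (t + u) = lieF_pder t + lieF_pder u.
Proof. exact: tliftD lift_pder_balanced. Qed.

Lemma lieF_pder0 : lieF_pder (0 : lieF i H) = 0.
Proof. exact: tlift_zero lift_pder_balanced. Qed.

Lemma lieF_pderZ (c : F) (t : lieF i H) a :
  lieF_pder (c *: t) a = (c : asmod (Fk i)) * lieF_pder t a.
Proof.
elim/(@tens_ind k (lie H) (asmod (Fk i))): t => [|t u ht hu|d l].
- by rewrite scaler0 lieF_pder0 mulr0.
- rewrite scalerDr !lieF_pderD -[LHS]/(lieF_pder (c *: (t : lieF i H)) a +
    lieF_pder (c *: (u : lieF i H)) a).
  by rewrite ht hu -mulrDr.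
rewrite [c *: _]bchange_scale_pure !lieF_pder_pure.
by rewrite -[LHS]/(c * l * i (d a)) -mulrA.
Qed.

Lemma pderF_lieD (t u : lieF i H) (c : F) v :
  pderF (lieF_pder (t + c *: u)) v =
  pderF (lieF_pder t) v + c * pderF (lieF_pder u) v.
Proof. by apply: pderF_lin => a; rewrite lieF_pderD -lieF_pderZ. Qed.

Lemma pderF_lie0 v : pderF (lieF_pder (0 : lieF i H)) v = 0.
Proof.
have := pderF_lieD 0 0 (-1) v; rewrite scaleN1r subr0 mulN1r.
by rewrite subrr.
Qed.

Lemma pderF_lie_sum n (a : 'I_n -> F) (t : 'I_n -> lieF i H) v :
  pderF (lieF_pder (\sum_l a l *: t l)) v =
  \sum_l a l * pderF (lieF_pder (t l)) v.
Proof.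
apply: (big_rec2 (fun u x => pderF (lieF_pder u) v = x)) => [|l x u _ <-].
  exact: pderF_lie0.
by rewrite addrC pderF_lieD addrC.
Qed.

Variable r : action H (Fk i).

(** Both sides unfold to sums over the list representing [t]. This reduces vector fields to
    computations with [rho] and [pderF]. *)
Lemma lieF_vf_pderF t y : lieF_vf r t y = pderF (lieF_pder t) (rho r y).
Proof.
suff h (s : seq (lie H * asmod (Fk i))) :
    (\sum_(x <- s) (fun y : F => (x.2 : F) * vf r x.1 y)) y =
    pderF (\sum_(x <- s) lift_pder i x.1 (x.2 : F)) (rho r y) by exact: h.
elim: s => [|[d l] s IH].
  rewrite !big_nil (@pderF_lin 0 0 0 (-1)) ?mulN1r ?subrr // => a.
  by rewrite mulr0 addr0.
rewrite !big_cons fctE IH [RHS](@pderF_lin _ (\sum_(x <- s) lift_pder i x.1 (x.2 : F))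
  (lift_pder i d 1) l) => [|a].
  exact: addrC.
rewrite -[LHS]/(l * i (d a) + _) addrC; congr (_ + _).
by rewrite -[RHS]/(l * (1 * i (d a))) mul1r.
Qed.
End LieF.

(** * Points of Z_F, orbits and stabilizers *)

Section PointsZF.
Variables (k F : fieldType) (i : {rmorphism k -> F}) (H : affine_group k).
Variable r : action H (Fk i).
Local Notation E := (fixed_field r).

(** A copy of the tensor product that carries a nonzero ring structure, as polynomial evaluation
    requires of its target. *)
Definition ZFring : Type := tensA (FE r) (FE r).
HB.instance Definition _ := GRing.ComPzRing.on ZFring.
Fact ZFring_nz : (1 : ZFring) != 0.
Proof.
apply/eqP => /(congr1 (z0 r)) /eqP.
by rewrite rmorph0 [X in X == _]rmorph1 oner_eq0.
Qed.
HB.instance Definition _ := GRing.PzSemiRing_isNonZero.Build ZFring ZFring_nz.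

Definition zleft : {rmorphism F -> ZFring} :=
  (inla (FE r) (FE r) : {rmorphism FE r -> tensA (FE r) (FE r)}).
Definition zright : {rmorphism F -> ZFring} := alg_map (ZF r).

Lemma zleft_fixed e : fixed r e -> zleft e = zright e.
Proof. by move=> he; exact: (inla_inra (FE r) (FE r) (FixedElt he)). Qed.

Lemma toFE (R : algebra F) (z : alg_hom (ZF r) R) x :
  toF z x = z (inla (FE r) (FE r) x).
Proof. by []. Qed.

Lemma toF_inj (R : algebra F) (z z' : alg_hom (ZF r) R) :
  toF z =1 toF z' -> z =1 z'.
Proof.
move=> e; apply: (@tens_hom_ext E (FE r) (FE r) R (hom_map z) (hom_map z')) => c.
  exact: e.
by rewrite [LHS](hom_alg z) [RHS](hom_alg z').
Qed.

Lemma ZF_point (R : algebra F) (phi : {rmorphism F -> R}) :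
  (forall e : E, phi (fixed_val e) = alg_map R (fixed_val e)) ->
  exists z : alg_hom (ZF r) R, toF z =1 phi.
Proof.
move=> h; pose i' : {rmorphism E -> F} := val.
pose u := @AlgHom E (FE r) (restr i' R) phi h.
pose v := @AlgHom E (FE r) (restr i' R) (alg_map R) (fun _ => erefl).
have zP (c : F) : copair u v (alg_map (ZF r) c) = alg_map R c.
  exact: copair_inra.
by exists (@AlgHom F (ZF r) R (hom_map (copair u v)) zP) => x;
  exact: (copair_inla u v x).
Qed.

Lemma toF_z0 (R : algebra F) x : toF (z0_at r R) x = alg_map R x.
Proof.
rewrite toFE -[LHS]/(alg_map R (z0 r (inla (FE r) (FE r) x))).
by congr (alg_map R _); exact: (copair_inla (hom_id (FE r)) (hom_id (FE r)) x).
Qed.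

Variable a : forall R : algebra F, HF i H R -> alg_hom (ZF r) R -> alg_hom (ZF r) R.
Hypothesis aP : is_base_changed_action a.

Lemma toF_orbit (R : algebra F) (g : HF i H R) :
  toF (orbit_map a R g) =1 act r g (hom_restr i (hom_str R) : alg_hom (Fk i) (restr i R)).
Proof.
by move=> x; rewrite aP; apply: act_ext => // y; exact: toF_z0.
Qed.

(** The tangent point of [t] moves z_0 to the point y -> y + v(y) e, with v the vector field of [t];
    it fixes z_0 exactly when v vanishes. *)
Lemma lie_inertiaP (t : lieF i H) :
  lie_inertia a t <-> lieF_vf r t =1 (fun=> 0).
Proof.
have orb y :
    toF (orbit_map a (dual (base F)) (tpoint (lieF_pder t))) y =
    (y, lieF_vf r t y).
  rewrite toF_orbit lieF_vf_pderF [LHS]surjective_pairing; congr pair.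
  by rewrite -[RHS](aug_rho r) -(pderF1 (lieF_pder t)).
split=> [h y|h].
  have := toF_z0 (dual (base F)) y; rewrite toFE -h -toFE orb => /(congr1 snd).
  by [].
by apply: toF_inj => y; rewrite [LHS]orb h toF_z0.
Qed.

Lemma orbit_map_nat (R R' : algebra F) (u : alg_hom R R') (g : HF i H R) :
  orbit_map a R' (hom_comp (hom_restr i u) g) =1 hom_comp u (orbit_map a R g).
Proof.
apply: toF_inj => y; rewrite toF_orbit.
rewrite -[RHS]/(u (toF (orbit_map a R g) y)) toF_orbit.
rewrite [RHS](act_nat r (hom_restr i u)); apply: act_ext => // c.
by rewrite -[RHS]/(u (alg_map R c)) hom_alg.
Qed.

(** The coset argument: the two translates of the base point [x0] agree exactly when the inverse of
    [g] times [g'] stabilizes it. *)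
Lemma orbit_map_fibre (R : algebra F) (g g' : HF i H R) :
  orbit_map a R g =1 orbit_map a R g' <->
  exists n : HF i H R, inertia a R n /\ g' =1 pt_mul g n.
Proof.
pose x0 : alg_hom (Fk i) (restr i R) := hom_restr i (hom_str R).
have inertiaP (n : HF i H R) : inertia a R n <-> act r n x0 =1 x0.
  split=> [h y|h].
    by rewrite -toF_orbit toFE h -toFE toF_z0.
  by apply: toF_inj => y; rewrite toF_orbit h toF_z0.
have orbP : orbit_map a R g =1 orbit_map a R g' <-> act r g x0 =1 act r g' x0.
  split=> [h y|h]; first by rewrite -!toF_orbit !toFE h.
  by apply: toF_inj => y; rewrite !toF_orbit h.
rewrite orbP; split=> [h|[n [/inertiaP hn e]] y]; last first.
  rewrite (act_ext r e (fun _ => erefl)) act_mul.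
  by apply: act_ext.
pose gV : alg_hom H (restr i R) := hom_comp g (antipode H).
exists (pt_mul gV g'); split.
  apply/inertiaP => y; rewrite act_mul.
  rewrite -(act_ext r (g := gV) (fun _ => erefl) h) -act_mul.
  by rewrite (act_ext r (@pt_mulV k H _ g) (fun _ => erefl)) act_one.
move=> b; rewrite [RHS]pt_mulA -[LHS]pt_mul1.
by apply: pt_mul_ext => // c; rewrite [RHS]pt_mulrV.
Qed.
End PointsZF.

(** * Frobenius on the coordinate ring of H_F *)

Section Frobenius.
Variables (k F : fieldType) (p : nat) (i : {rmorphism k -> F}).
Variable H : affine_group k.
Hypothesis hp : p \in [pchar k].
Hypothesis hH : height_one p H.
Local Notation scal := (scal i H).
Local Notation gen := (gen i H).
Local Notation aug := (aug i H).

Lemma pchar_F : p \in [pchar F].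
Proof. exact: (rmorph_pchar i). Qed.

Lemma pchar_coordF : p \in [pchar coordF i H].
Proof. exact: (rmorph_pchar scal pchar_F). Qed.

(** Height one gives this on the elements coming from [H], and both sides are multiplicative and, in
    characteristic p, additive. *)
Lemma coordF_frobenius (u : coordF i H) : u ^+ p = scal (aug u ^+ p).
Proof.
elim/coordF_ind: u => [c|a|u v hu hv|u v hu hv].
- by rewrite aug_scal rmorphXn.
- by rewrite -[LHS]rmorphXn (proj2 hH) gen_alg aug_gen (rmorphXn i).
- rewrite rmorphD !exprDn_pchar ?hu ?hv ?rmorphD //.
    by rewrite (eq_pnat _ (pcharf_eq pchar_F)) pnat_id // (pcharf_prime hp).
  by rewrite (eq_pnat _ (pcharf_eq pchar_coordF)) pnat_id // (pcharf_prime hp).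
by rewrite rmorphM !exprMn hu hv rmorphM.
Qed.

Lemma coordF_aug0 (u : coordF i H) : aug u = 0 -> u ^+ p = 0.
Proof.
move=> u0; rewrite coordF_frobenius u0 expr0n -leqn0 leqNgt prime_gt0 ?rmorph0 //.
exact: pcharf_prime hp.
Qed.

(** Generators of [H] are shifted by constants so as to vanish at the origin. *)
Lemma coordF_generators : exists N (y : 'I_N -> coordF i H),
  (forall j, aug (y j) = 0) /\ forall u, exists q, mmap scal y q = u.
Proof.
have [[N [x xgen]] _] := hH.
exists N, (fun j => gen (x j) - scal (i (counit H (x j)))); set y := fun j => _.
split=> [j|]; first by rewrite rmorphB aug_gen aug_scal subrr.
pose Q u := exists q, mmap scal y q = u.
have Qc c : Q (scal c) by exists c%:MP; rewrite mmapC.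
have QD u v : Q u -> Q v -> Q (u + v).
  by move=> [q <-] [q' <-]; exists (q + q'); rewrite rmorphD.
have QM u v : Q u -> Q v -> Q (u * v).
  by move=> [q <-] [q' <-]; exists (q * q'); rewrite rmorphM.
apply: (coordF_ind (Q := Q)) => // a; have [q ->] := xgen a.
rewrite rmorph_sum; apply: big_ind => [||m _]; first by rewrite -(rmorph0 scal).
  exact: QD.
rewrite rmorphM gen_alg; apply: (QM) => //.
rewrite rmorph_prod; apply: big_ind => [||j _]; first by rewrite -(rmorph1 scal).
  exact: QM.
have Qx : Q (gen (x j)).
  rewrite -[gen _](subrK (scal (i (counit H (x j))))); apply: QD => //.
  by exists 'X_j; rewrite mmapXU.
rewrite rmorphXn; elim: (m j) => [|e IH]; first by rewrite expr0 -(rmorph1 scal).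
by rewrite exprS; apply: QM.
Qed.
End Frobenius.

(** * Coordinates adapted to the orbit of z_0 *)

Section Structure.
Variables (k F : fieldType) (p : nat) (i : {rmorphism k -> F}).
Variable H : affine_group k.
Hypothesis hp : p \in [pchar k].
Hypothesis hH : height_one p H.
Variable r : action H (Fk i).
Local Notation scal := (scal i H).
Local Notation gen := (gen i H).
Local Notation aug := (aug i H).
Local Notation rho := (rho r).
Variables (N : nat) (y : 'I_N -> coordF i H).
Hypothesis aug_y : forall j, aug (y j) = 0.
Hypothesis y_gen : forall u, exists q, mmap scal y q = u.
Variables (n : nat) (x : 'I_n -> H) (d : 'I_n -> lie H).
Hypothesis eps_x : forall l, counit H (x l) = 0.
Hypothesis d_x : forall l m, d l (x m) = (l == m)%:R.
Hypothesis d_small : forall a,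
  aug_sq (a - alg_map H (counit H a) - \sum_l alg_map H (d l a) * x l).

Definition diff l (u : coordF i H) : F := pderF (lift_pder i (d l) 1) u.

Lemma diff_gen l a : diff l (gen a) = i (d l a).
Proof. by rewrite /diff pderF_gen -[LHS]/(1 * i (d l a)) mul1r. Qed.

Let y_p j : y j ^+ p = 0.
Proof. exact: (coordF_aug0 hp hH (aug_y j)). Qed.

Let augpow1 u : aug u = 0 -> augpow y 1 u.
Proof. exact: (augpow1 (@aug_scal _ _ i H) aug_y y_gen). Qed.

Lemma augpow2_gen a : aug_sq a -> augpow y 2 (gen a).
Proof.
elim=> [|a' b' _ ha _ hb|a' b' ha hb]; first by rewrite rmorph0; exact: augpow0.
  by rewrite rmorphD; exact: augpowD.
by rewrite rmorphM; apply: (augpowM (m := 1)); apply: augpow1;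
  rewrite aug_gen ?ha ?hb rmorph0.
Qed.

(** The first-order Taylor expansion at the origin: it comes from [d_small] on elements of [H] and
    is stable under sums and products. *)
Lemma augpow2_diff u :
  augpow y 2 (u - scal (aug u) - \sum_l scal (diff l u) * gen (x l)).
Proof.
elim/coordF_ind: u => [c|a|u v hu hv|u v hu hv].
- rewrite aug_scal subrr sub0r big1 ?oppr0; first exact: augpow0.
  by move=> l _; rewrite /diff pderF_scal rmorph0 mul0r.
- have := augpow2_gen (d_small a).
  rewrite !rmorphB rmorph_sum aug_gen -gen_alg /=.
  under eq_bigr do rewrite rmorphM gen_alg -diff_gen.
  by [].
- have := augpowD hu hv; congr (augpow _ _ _).
  rewrite rmorphD [in RHS](eq_bigr (fun l =>
    scal (diff l u) * gen (x l) + scal (diff l v) * gen (x l))).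
    by rewrite big_split /= !rmorphD; ring.
  by move=> l _; rewrite /diff pderFD rmorphD mulrDl.
pose D u := \sum_l scal (diff l u) * gen (x l).
rewrite -/(D _) in hu; rewrite -/(D _) in hv; rewrite -/(D _).
have DM : D (u * v) = scal (aug u) * D v + scal (aug v) * D u.
  rewrite /D !mulr_sumr -big_split; apply: eq_bigr => l _ /=.
  by rewrite /diff pderFM rmorphD !rmorphM; ring.
have -> : u * v - scal (aug (u * v)) - D (u * v) =
    (u - scal (aug u)) * (v - scal (aug v)) +
    (scal (aug u) * (v - scal (aug v) - D v) + scal (aug v) * (u - scal (aug u) - D u)).
  by rewrite DM !rmorphM; ring.
apply: augpowD; last by apply: augpowD; exact: augpowMl.
by apply: (augpowM (m := 1)); apply: augpow1; rewrite rmorphB aug_scal subrr.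
Qed.

(** By [lpoint_rho] the right-invariant derivations of the basis [d] kill [rho e], which is
    therefore constant, equal to its value [e] at the origin. This is what makes H_F act on Z_F. *)
Lemma rho_fixed e : fixed r e -> rho e = scal e.
Proof.
move=> /asboolP he.
pose w l := gen (x l).
pose D l := point_deriv (lpoint (lift_pder i (d l) 1)).
have aug_w l : aug (w l) = 0 by rewrite aug_gen eps_x rmorph0.
have w_p l : w l ^+ p = 0 := coordF_aug0 hp hH (aug_w l).
have D_deriv l : kderiv scal (D l) := point_deriv_kderiv (lpoint1 _).
have D_dual l m : aug (D l (w m)) = (l == m)%:R.
  rewrite (aug_point_deriv _ (lpoint_aug _)) -/(diff l _) diff_gen d_x.
  by rewrite rmorph_nat.
have w_span u : aug u = 0 ->
    exists c : 'I_n -> F, augpow y 2 (u - \sum_l scal (c l) * w l).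
  move=> u0; exists (fun l => diff l u).
  by have := augpow2_diff u; rewrite u0 rmorph0 subr0.
have [c hc] : exists c, rho e - scal e = scal c.
  apply: (deriv_kernel (pchar_F i hp) (@aug_scal _ _ i H) aug_y y_p y_gen
    aug_w w_p w_span D_deriv D_dual (T := predT)
    (Q := fun u => exists c, u = scal c)) => //.
  - move=> l _; have [DD _ Dc] := D_deriv l.
    apply: (addIr (D l (scal e))); rewrite -DD subrK Dc add0r.
    by rewrite /D lpoint_rho he rmorph0.
  - by move=> c; exists c.
  - by move=> _ _ [a ->] [b ->]; exists (a + b); rewrite rmorphD.
  - by move=> _ _ [a ->] [b ->]; exists (a * b); rewrite rmorphM.
apply/eqP; rewrite -subr_eq0 hc; have := congr1 aug hc.
by rewrite rmorphB aug_rho !aug_scal subrr => <-; rewrite rmorph0.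
Qed.

(* A relation of minimal length has all [b j] fixed, since [rho_deriv] kills the
   [rho (a j)] and so yields a second relation with coefficients [vf d0 (b j)]. *)
Lemma rho_combination (L : F -> Prop) :
  L 0 -> (forall a b, L a -> L b -> L (a + b)) ->
  (forall e a, fixed r e -> L a -> L (a * e)) ->
  forall m (a b : 'I_m -> F) z, (forall j, L (a j)) ->
    rho z = \sum_j rho (a j) * scal (b j) -> L z.
Proof.
move=> L0 LD LE; elim=> [|m IH] a b z La hz.
  by rewrite -(aug_rho r z) hz big_ord0 rmorph0.
have [bE|] := pselect (forall j, fixed r (b j)).
  have -> : z = \sum_j a j * b j.
    rewrite -(aug_rho r z) hz rmorph_sum; apply: eq_bigr => j _.
    by rewrite rmorphM /= aug_rho aug_scal.
  by apply: (big_ind L) => // j _; exact: LE.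
move=> /existsNP[j nj].
have [d0 nz] : exists d0, vf r d0 (b j) <> 0.
  by apply/existsNP => h; apply: nj; apply/asboolP.
pose n0 := lift_pder i d0 1.
have nz' : vf r d0 (b j) != 0 by apply/eqP.
have rel : \sum_l rho (a l) * scal (vf r d0 (b l)) = 0.
  rewrite -[RHS](rho_deriv_rho r n0 z) hz.
  rewrite (big_morph (rho_deriv r n0) (rho_derivD r n0) (id1 := 0)); last first.
    by rewrite -(rmorph0 rho) rho_deriv_rho rmorph0.
  apply: eq_bigr => l _.
  by rewrite rho_derivM rho_deriv_rho mul0r addr0 rho_deriv_scal.
(* The normalization [q j = 1] makes [b j - b j * q j] vanish, so the index [j] drops out of the
   relation. *)
pose q l := vf r d0 (b l) / vf r d0 (b j).
apply: (IH (fun l => a (lift j l)) (fun l => b (lift j l) - b j * q (lift j l))) => //.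
have rel' : \sum_l rho (a l) * scal (b j * q l) = 0.
  transitivity (scal (b j / vf r d0 (b j)) * \sum_l rho (a l) * scal (vf r d0 (b l))).
    rewrite mulr_sumr; apply: eq_bigr => l _.
    by rewrite [RHS]mulrCA -rmorphM /q mulrA mulrAC.
  by rewrite rel mulr0.
have -> : rho z = \sum_l rho (a l) * scal (b l - b j * q l).
  rewrite -[LHS]subr0 -[X in _ - X]rel' hz -sumrB; apply: eq_bigr => l _.
  by rewrite rmorphB mulrBr.
rewrite (bigD1_ord j) //= /q divff // mulr1 subrr rmorph0 mulr0 add0r.
by [].
Qed.

(** The [z m] separate the vector fields of h.F, and the matrix of their derivatives is completed to
    an invertible [g]. Then [w] has Jacobian [g] at the origin, and [t] is the dual basis given by
    the inverse of [g]. *)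
Lemma adapted_coordinates : exists c (z : 'I_c -> F) (w : 'I_n -> coordF i H)
    (j : 'I_c -> 'I_n) (t : 'I_n -> lieF i H),
  [/\ injective j /\ (forall m, w (j m) = rho (z m) - scal (z m)),
      (forall m, aug (w m) = 0),
      forall l m, pderF (lieF_pder (t l)) (w m) = (l == m)%:R,
      forall u, aug u = 0 ->
        exists c : 'I_n -> F, augpow y 2 (u - \sum_l scal (c l) * w l) &
      forall l, (forall m, j m != l) -> lieF_vf r (t l) =1 (fun=> 0)].
Proof.
have [c [z [fz zmax]]] := row_free_points (fun l => vf r (d l)).
have [g [j [ij gu gE]]] := row_free_complete fz.
pose h := invmx g.
pose w m := if [pick l | j l == m] is Some l then rho (z l) - scal (z l)
  else \sum_l scal (g m l) * gen (x l).
have wj m : w (j m) = rho (z m) - scal (z m).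
  rewrite /w; case: pickP => [l /eqP /ij -> //|/(_ m)]; by rewrite eqxx.
have diff0 l : diff l 0 = 0 by rewrite -(rmorph0 scal) /diff pderF_scal.
have diffD l u v : diff l (u + v) = diff l u + diff l v by exact: pderFD.
have diffM l a u : diff l (scal a * u) = a * diff l u.
  by rewrite /diff pderFM pderF_scal mul0r addr0 aug_scal.
have diff_sum l (u : 'I_n -> coordF i H) : diff l (\sum_m u m) = \sum_m diff l (u m).
  exact: (big_morph (diff l) (diffD l) (diff0 l)).
have diffw l m : diff l (w m) = g m l.
  rewrite /w; case: pickP => [l' /eqP <-|_].
    rewrite gE mxE diffD -mulN1r -(rmorphN1 scal) diffM {2}/diff pderF_scal.
    by rewrite mulr0 addr0.
  rewrite diff_sum (bigD1 l) //= diffM diff_gen d_x eqxx rmorph1 mulr1.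
  rewrite big1 ?addr0 // => l' ne; rewrite diffM diff_gen d_x eq_sym (negPf ne).
  by rewrite rmorph0 mulr0.
pose t m : lieF i H := \sum_l h l m *: (pure (d l) (1 : asmod (Fk i)) : lieF i H).
have tE m u : pderF (lieF_pder (t m)) u = \sum_l h l m * diff l u.
  by rewrite pderF_lie_sum; apply: eq_bigr => l _; rewrite lieF_pder_pure.
have tw l m : pderF (lieF_pder (t l)) (w m) = (l == m)%:R.
  have := congr1 (fun A : 'M_n => A m l) (mulmxV gu); rewrite !mxE eq_sym => <-.
  by rewrite tE; apply: eq_bigr => l' _; rewrite diffw mulrC.
have aug_w m : aug (w m) = 0.
  rewrite /w; case: pickP => [l _|_]; first by rewrite rmorphB aug_rho aug_scal subrr.
  rewrite rmorph_sum big1 // => l _.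
  by rewrite rmorphM /= aug_gen eps_x rmorph0 mulr0.
exists c, z, w, j, t; split=> // [u u0|l nl v].
  (* The coefficients are the derivatives of [u] along [t]; the remainder has zero differential, so
     [augpow2_diff] puts it in the square. *)
  exists (fun m => pderF (lieF_pder (t m)) u); set u' := u - _.
  have := augpow2_diff u'; have -> : aug u' = 0.
    rewrite rmorphB u0 rmorph_sum big1 ?subrr // => l _.
    by rewrite rmorphM /= aug_w mulr0.
  rewrite rmorph0 subr0 big1 ?subr0 // => l _.
  suff -> : diff l u' = 0 by rewrite rmorph0 mul0r.
  rewrite diffD -mulN1r -(rmorphN1 scal) diffM mulN1r diff_sum.
  apply/eqP; rewrite subr_eq0; apply/eqP.
  under eq_bigr do rewrite diffM diffw tE mulr_suml.
  rewrite exchange_big (bigD1 l) //= [X in _ + X]big1 ?addr0 => [|m ml].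
    have := congr1 (fun A : 'M_n => A l l) (mulVmx gu); rewrite !mxE eqxx => hl.
    under eq_bigr do rewrite mulrAC.
    by rewrite -mulr_suml hl mul1r.
  have := congr1 (fun A : 'M_n => A m l) (mulVmx gu); rewrite !mxE (negPf ml) => hl.
  under eq_bigr do rewrite mulrAC.
  by rewrite -mulr_suml hl mul0r.
(* For [l] outside the image of [j], duality with [w] shows that [t l] kills every [z m]; by the
   choice of these its vector field is zero. *)
rewrite lieF_vf_pderF tE; apply: (zmax (h ^~ l)) => m.
have := tw l (j m); rewrite wj tE eq_sym (negPf (nl m)) => e; rewrite -[RHS]e.
apply: eq_bigr => l' _; congr (_ * _).
rewrite diffD -mulN1r -(rmorphN1 scal) diffM [diff _ (scal _)]pderF_scal.
by rewrite mulr0 addr0.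
Qed.

(** By Frobenius [rho (z ^+ p)] is constant, and [pderF] kills constants. *)
Lemma fixed_pth_power z : fixed r (z ^+ p).
Proof.
apply/asboolP => d0; rewrite vf_pderF rmorphXn (coordF_frobenius hp hH).
exact: pderF_scal.
Qed.

(** The [z m] serve as coordinates on the orbit: they have dual vector fields, generate F over E,
    and allow a section of the orbit morphism, given by [s] on coordinate rings. *)
Lemma orbit_coordinates : exists c (z : 'I_c -> F) (t : 'I_c -> lieF i H),
  [/\ forall l m, lieF_vf r (t l) (z m) = (l == m)%:R,
      forall L : F -> Prop,
        (forall e, fixed r e -> L e) -> (forall m, L (z m)) ->
        (forall a b, L a -> L b -> L (a + b)) ->
        (forall a b, L a -> L b -> L (a * b)) -> forall a, L a &
      exists s : {rmorphism coordF i H -> ZFring r},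
        (forall a, s (scal a) = zright r a) /\ forall a, s (rho a) = zleft r a].
Proof.
have [c [z [w [j [t [[ij wj] aug_w tw w_span tinert]]]]]] := adapted_coordinates.
have w_p m : w m ^+ p = 0 := coordF_aug0 hp hH (aug_w m).
pose D l := point_deriv (rpoint (lieF_pder (t l))).
have D_deriv l : kderiv scal (D l) := point_deriv_kderiv (rpoint1 _).
have D_dual l m : aug (D l (w m)) = (l == m)%:R.
  by rewrite (aug_point_deriv _ (rpoint_aug _)).
(* The indices of [T] do not come from the [z m]; their vector fields vanish, so their
   left-invariant derivations kill the image of [rho]. *)
pose T l := [forall m, j m != l].
have D_rho l a : T l -> D l (rho a) = 0.
  move=> /forallP Tl; apply: rpoint_inert => b.
  by rewrite -lieF_vf_pderF tinert.
have generated (L : F -> Prop) :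
    (forall e, fixed r e -> L e) -> (forall m, L (z m)) ->
    (forall a b, L a -> L b -> L (a + b)) ->
    (forall a b, L a -> L b -> L (a * b)) -> forall a, L a.
  move=> LE Lz LD LM a.
  have L0 : L 0 by apply/LE/asboolP => d0;
    rewrite -[X in vf r d0 X](rmorph0 i) vf_alg.
  have L1 : L 1 by apply/LE/asboolP => d0;
    rewrite -[X in vf r d0 X](rmorph1 i) vf_alg.
  pose Q u := exists2 s : seq (F * F), forall q, q \in s -> L q.1 &
    u = \sum_(q <- s) rho q.1 * scal q.2.
  have Q1 b b' : L b -> Q (rho b * scal b').
    move=> Lb; exists [:: (b, b')]; last by rewrite big_seq1.
    by move=> q; rewrite inE => /eqP ->.
  (* By [deriv_kernel], [rho a] is a polynomial in the [w m] outside [T], which are differences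
     [rho (z m') - scal (z m')]. *)
  have [s Ls] : Q (rho a).
    apply: (deriv_kernel (pchar_F i hp) (@aug_scal _ _ i H) aug_y y_p y_gen
      aug_w w_p w_span D_deriv D_dual (T := T)).
    - move=> l m Tl; rewrite negb_forall => /existsP[m']; rewrite negbK => /eqP <-.
      have [DD _ Dc] := D_deriv l.
      by apply: (addIr (D l (scal (z m')))); rewrite -DD wj subrK D_rho // Dc addr0.
    - by move=> l; exact: D_rho.
    - by move=> b; rewrite -[scal b]mul1r -(rmorph1 rho); exact: Q1.
    - move=> m; rewrite negb_forall => /existsP[m']; rewrite negbK => /eqP <-.
      exists [:: (z m', 1); (1, - z m')].
        by move=> q; rewrite !inE => /orP[] /eqP -> /=.
      by rewrite wj !big_cons big_nil /= !rmorph1 mulr1 mul1r addr0 rmorphN.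
    - move=> u v [s Ls ->] [s' Ls' ->]; exists (s ++ s'); last by rewrite big_cat.
      by move=> q; rewrite mem_cat => /orP[]; [exact: Ls | exact: Ls'].
    move=> u v [s Ls ->] [s' Ls' ->].
    exists [seq (q.1 * q'.1, q.2 * q'.2) | q <- s, q' <- s'].
      by move=> q /allpairsP[[q1 q2] /= [/Ls L1' /Ls' L2' ->]]; exact: LM.
    rewrite big_allpairs_dep big_distrlr /=; apply: eq_bigr => q _.
    by apply: eq_bigr => q' _; rewrite !rmorphM mulrACA.
  rewrite (big_nth (0, 0)) big_mkord.
  apply: rho_combination => // [e b he Lb|m]; first by apply: LM => //; exact: LE.
  by apply: Ls; exact: mem_nth.
exists c, z, (fun l => t (j l)); split=> // [l m|].
  have := tw (j l) (j m); rewrite wj (inj_eq ij) lieF_vf_pderF => <-.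
  apply: (addIr (pderF (lieF_pder (t (j l))) (scal (z m)))).
  by rewrite -[RHS]pderFD subrK pderF_scal addr0.
pose b m : ZFring r := if [pick l | j l == m] is Some l
  then zleft r (z l) - zright r (z l) else 0.
have bp m : b m ^+ p = 0.
  have p0 : (0 < p)%N by rewrite prime_gt0 // (pcharf_prime hp).
  rewrite /b; case: pickP => [l _|_]; last by rewrite expr0n gtn_eqF.
  have hpZ : p \in [pchar ZFring r] := rmorph_pchar (zright r) (pchar_F i hp).
  transitivity (zleft r (z l) ^+ p - zright r (z l) ^+ p).
    exact: (pFrobenius_autB_comm hpZ (mulrC _ _)).
  (* The two p-th powers agree because [z l ^+ p] lies in E. *)
  rewrite -!rmorphXn zleft_fixed ?subrr //.
  exact: fixed_pth_power.
have [s [s_scal s_w]] := truncated_extend (pchar_F i hp) (@aug_scal _ _ i H)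
  aug_y y_p y_gen aug_w w_p w_span D_deriv D_dual (zright r) bp.
(* The maps [s \o rho] and [zleft r] agree on E and on the [z m], which generate F. *)
exists s; split=> //; apply: generated => [e he|m|a b' ha hb|a b' ha hb].
- by rewrite rho_fixed // s_scal zleft_fixed.
- rewrite -(subrK (scal (z m)) (rho (z m))) -wj rmorphD s_w s_scal /b.
  by case: pickP => [l /eqP/ij ->|/(_ m)]; rewrite ?subrK ?eqxx.
- by rewrite !rmorphD ha hb.
- by rewrite !rmorphM ha hb.
Qed.
End Structure.

(** * The identity as an fppf cover *)

Section FppfId.
Variable R : comNzRingType.
Local Notation N := (asmod (Algebra (idfun : {rmorphism R -> R}))).

Definition tens_id (M : lmodType R) (m : M) (c : N) : M := (c : R) *: m.

Lemma tens_id_balanced (M : lmodType R) : balanced (@tens_id M).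
Proof.
split=> [m m' c|m c c'|a m c]; rewrite /tens_id ?scalerDr ?scalerDl //.
by rewrite -[a *: c]/(a * (c : R)) !scalerA mulrC.
Qed.

Lemma tens_idE (M : lmodType R) (t : tens M N) :
  t = pure (tlift (@tens_id M) t) (1 : N).
Proof.
have b := tens_id_balanced M.
have [bD _ bZ] := @pure_balanced R M N.
elim/(@tens_ind R M N): t => [|t u ht hu|m c].
- by rewrite [tlift _ _](tlift_zero b) (balanced0l _ (@pure_balanced R M N)).
- by rewrite tliftD // bD -ht -hu.
rewrite tlift_pure // /tens_id bZ; congr pure.
by rewrite -[RHS]/((c : R) * 1) mulr1.
Qed.

(** Tensoring with [R] over itself changes nothing, and [R] is presented by no generators and no
    relations. *)
Lemma fppf_id : fppf (idfun : {rmorphism R -> R}).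
Proof.
split; [split|].
- move=> M M' f finj x x'; rewrite (tens_idE x) (tens_idE x').
  set m := tlift _ x; set m' := tlift _ x'.
  have fb : balanced (fun m (c : N) => pure (f m) c).
    have [b1 b2 b3] := @pure_balanced R M' N.
    by split=> [u v c|u c c'|a u c]; rewrite ?linearD ?b1 ?b2 // linearZ b3.
  rewrite /tmap !tlift_pure // => /(congr1 (tlift (@tens_id M'))).
  rewrite !tlift_pure; try exact: tens_id_balanced.
  by rewrite /tens_id !scale1r => /finj ->.
- move=> M h m; have := congr1 (tlift (@tens_id M)) (h (pure m (1 : N))).
  rewrite tlift_pure; last exact: tens_id_balanced.
  by rewrite /tens_id scale1r => ->; exact: (tlift_zero (tens_id_balanced M)).
have x0 : 'I_0 -> R by case.
have r0 : 'I_0 -> {mpoly R[0]} by case.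
exists 0%N, x0; split=> [c|]; first by exists c%:MP; rewrite mmapC.
exists 0%N, r0 => q.
have qE : q = (q@_0)%:MP.
  apply/mpolyP => m; rewrite mcoeffC; suff -> : m = 0%MM by rewrite eqxx mulr1.
  by apply/mnmP => -[].
split=> [h|[c ->]]; last by rewrite big_ord0 mmap0.
by exists r0; rewrite big_ord0 qE; move: h;
  rewrite {1}qE mmapC /= => ->; rewrite mpolyC0.
Qed.
End FppfId.

(** * Monomials with exponents below p as a basis *)

Section Monomials.
Variables (K : fieldType) (p : nat) (S : fieldType) (f : {rmorphism K -> S}).
Hypothesis hp : p \in [pchar K].
Variables (c : nat) (z : 'I_c -> S).
Local Notation box := {ffun 'I_c -> 'I_p}.

Definition monomial (m : 'I_c -> nat) : S := \prod_j z j ^+ m j.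

(** Exponents are reduced modulo [p], the factors [z j ^+ p] being absorbed into the coefficient;
    hence the span is closed under products. *)
Lemma monomials_span :
  (forall j, exists e, f e = z j ^+ p) ->
  (forall L : S -> Prop, (forall e, L (f e)) -> (forall j, L (z j)) ->
     (forall a b, L a -> L b -> L (a + b)) ->
     (forall a b, L a -> L b -> L (a * b)) -> forall u, L u) ->
  forall u, exists a : box -> K, u = \sum_s f (a s) * monomial (fun j => s j).
Proof.
move=> zp gen; have p0 : (0 < p)%N by rewrite prime_gt0 // (pcharf_prime hp).
pose L u := exists a : box -> K, u = \sum_s f (a s) * monomial (fun j => s j).
have LD u v : L u -> L v -> L (u + v).
  move=> [a ->] [b ->]; exists (fun s => a s + b s).
  by rewrite -big_split; apply: eq_bigr => s _; rewrite rmorphD mulrDl.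
have L0 : L 0.
  by exists (fun=> 0); rewrite big1 // => s _; rewrite rmorph0 mul0r.
have Lm e (m : 'I_c -> nat) : L (f e * monomial m).
  pose s0 : box := [ffun j => Ordinal (ltn_pmod (m j) p0)].
  pose q j := projT1 (cid (zp j)).
  have qE j : f (q j) = z j ^+ p := projT2 (cid (zp j)).
  exists (fun s => if s == s0 then e * \prod_j q j ^+ (m j %/ p) else 0).
  rewrite (bigD1 s0) //= eqxx [X in _ + X]big1 ?addr0 => [|s /negPf ->]; last first.
    by rewrite rmorph0 mul0r.
  rewrite rmorphM rmorph_prod -mulrA -big_split; congr (_ * _).
  apply: eq_bigr => j _ /=.
  by rewrite ffunE /= rmorphXn /= qE -exprM -exprD mulnC -divn_eq.
apply: gen (LD) _ => [e|j|_ _ [a ->] [b ->]].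
- have := Lm e (fun=> 0%N); rewrite /monomial big1 ?mulr1 // => j _.
- have := Lm 1 (fun l => (l == j) : nat); rewrite rmorph1 mul1r /monomial.
  rewrite (bigD1 j) //= eqxx expr1 big1 ?mulr1 // => l /negPf ->.
  exact: expr0.
rewrite big_distrlr; apply: (big_ind L) => // s _.
apply: (big_ind L) => // s' _ /=.
have := Lm (a s * b s') (fun j => s j + s' j)%N.
congr L; rewrite mulrACA -rmorphM; congr (_ * _).
by rewrite -big_split; apply: eq_bigr => j _; rewrite exprD.
Qed.

(** Derivations dual to the [z j] make the kernel of evaluation at [z] stable under partial
    derivatives, so [truncated_eq0] applies. *)
Lemma monomials_free (D : 'I_c -> S -> S) :
  (forall l, kderiv f (D l)) -> (forall l j, D l (z j) = (l == j)%:R) ->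
  forall a : box -> K, \sum_s f (a s) * monomial (fun j => s j) = 0 ->
  forall s, a s = 0.
Proof.
move=> hD Dz a a0 s.
pose mon (s : box) : 'X_{1..c} := [multinom (s j : nat) | j < c].
have mon_inj s1 s2 : mon s1 = mon s2 -> s1 = s2.
  move=> /mnmP h; apply/ffunP => j; apply: val_inj.
  by have := h j; rewrite !mnmE.
pose q : {mpoly K[c]} := \sum_s a s *: 'X_[mon s].
have q0 : q = 0.
  apply: (truncated_eq0 hp (g := f) (b := z)).
  - move=> q' q'0 l; have := kderiv_mmap z q' (hD l).
    rewrite q'0 (kderiv0 (hD l)) (bigD1 l) //= Dz eqxx mulr1 big1 ?addr0 //.
    by move=> j; rewrite eq_sym => /negPf ne; rewrite Dz ne mulr0.
  - move=> m nm; rewrite raddf_sum /= big1 // => s' _.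
    rewrite mcoeffZ mcoeffX; case: eqP => [mE|_]; last by rewrite mulr0.
    case/negP: nm; rewrite -mE; apply/forallP => j.
    by rewrite mnmE.
  rewrite raddf_sum -[RHS]a0; apply: eq_bigr => s' _ /=.
  rewrite mmapZ mmapX; congr (_ * _); apply: eq_bigr => j _.
  by rewrite mnmE.
have := congr1 (mcoeff (mon s)) q0.
rewrite raddf_sum mcoeff0 (bigD1 s) //= mcoeffZ mcoeffX eqxx mulr1.
rewrite big1 ?addr0 // => s' ne; rewrite mcoeffZ mcoeffX.
by case: eqP => [/mon_inj e|_]; [rewrite e eqxx in ne | rewrite mulr0].
Qed.
End Monomials.

(** * The action on Z_F and the E-derivations of F *)

Section FixedField.
Variables (k F : fieldType) (i : {rmorphism k -> F}) (H : affine_group k).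
Variable r : action H (Fk i).
Local Notation E := (fixed_field r).

Definition incl : {rmorphism E -> F} := val.

(** As [rho] agrees with [scal] on E, translating the image of a point of Z_F in Spec F does not
    change its restriction to E, so the translate defines a point of Z_F. *)
Lemma base_changed_action_exists :
  (forall e, fixed r e -> rho r e = scal i H e) ->
  exists a : forall R : algebra F, HF i H R -> alg_hom (ZF r) R -> alg_hom (ZF r) R,
    is_base_changed_action a.
Proof.
move=> fixedE.
have ex (R : algebra F) (g : HF i H R) (z : alg_hom (ZF r) R) :
    exists z' : alg_hom (ZF r) R, toF z' =1 act r g (toF z).
  apply: (ZF_point (phi := hom_map (act r g (toF z)))) => -[e he] /=.
  transitivity (copair g (toF z) (rho r e)); first by [].
  rewrite fixedE // [LHS]copair_inra toFE.
  by rewrite -(hom_alg z) -[inla _ _ _]/(zleft r e) zleft_fixed.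
by exists (fun R g z => projT1 (cid (ex R g z))) => R g z;
  exact: (projT2 (cid (ex R g z))).
Qed.

Lemma lieF_vf_kderiv (t : lieF i H) : kderiv incl (lieF_vf r t).
Proof.
split=> [u v|u v|[e he]]; rewrite !lieF_vf_pderF.
- by rewrite rmorphD pderFD.
- by rewrite rmorphM pderFM !aug_rho.
rewrite -lieF_vf_pderF; have /asboolP hv := he.
rewrite /lieF_vf /tlift /tsum fct_sumE big1 // => q _.
by rewrite [vf _ _ _]hv mulr0.
Qed.

Lemma F_spanP (D : F -> F) : F_span r D <-> exists t : lieF i H, lieF_vf r t =1 D.
Proof.
split=> [[n [l [d hD]]]|[t ht]].
  exists (\sum_j l j *: (pure (d j) (1 : asmod (Fk i)) : lieF i H)) => y.
  rewrite hD lieF_vf_pderF pderF_lie_sum; apply: eq_bigr => j _.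
  by rewrite lieF_pder_pure.
exists (size (repr t)), (fun j => (nth (0, 0) (repr t) j).2),
  (fun j => (nth (0, 0) (repr t) j).1) => y.
by rewrite -ht /lieF_vf /tlift /tsum fct_sumE (big_nth (0, 0)) big_mkord.
Qed.

Lemma lieF_vf_sub (t : lieF i H) c (a : 'I_c -> F) (u : 'I_c -> lieF i H) y :
  lieF_vf r (t - \sum_j a j *: u j) y =
  lieF_vf r t y - \sum_j a j * lieF_vf r (u j) y.
Proof.
rewrite !lieF_vf_pderF -scaleN1r pderF_lieD mulN1r pderF_lie_sum.
by congr (_ - _); apply: eq_bigr => j _; rewrite lieF_vf_pderF.
Qed.
End FixedField.

(** * The quotient, the inertia Lie algebra and the degree of F over E *)

Theorem proposition5p3 (k F : fieldType) (p : nat) (hp : p \in [pchar k])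
    (i : {rmorphism k -> F}) (H : affine_group k) (hH : height_one p H)
    (r : action H (Fk i)) (faithful : injective (vf r)) :
  exists a : forall R : algebra F,
      HF i H R -> alg_hom (ZF r) R -> alg_hom (ZF r) R,
    is_base_changed_action a /\
    [/\ is_quotient (inertia a) (orbit_map a),
        [/\ forall D : F -> F, F_span r D <-> is_Der_E r D,
            forall D : F -> F, F_span r D <-> exists t : lieF i H, lieF_vf r t =1 D &
            forall t : lieF i H, lie_inertia a t <-> lieF_vf r t =1 (fun=> 0)] &
        exists c : nat,
          has_codim (lie_inertia a) c /\ has_dim (asmod (FE r)) (p ^ c)%N].
Proof.
have [N [y [aug_y y_gen]]] := coordF_generators i hH.
have [n [x [d [eps_x d_x d_small]]]] := lie_basis (proj1 hH).
have [a ha] := base_changed_action_exists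
  (rho_fixed hp hH aug_y y_gen eps_x d_x d_small (r := r)).
exists a; split=> //.
have [c [z [t [tz generated [s [s_scal s_rho]]]]]] :=
  orbit_coordinates hp hH r aug_y y_gen eps_x d_x d_small.
(* The elements on which two E-derivations agree form a subring; it contains E and the [z m], which
   generate F. *)
have der_ext D D' : is_Der_E r D -> is_Der_E r D' ->
    (forall m, D (z m) = D' (z m)) -> D =1 D'.
  move=> [DD DM DE] [DD' DM' DE'] e; apply: generated => [b hb|//|b b' h h'|b b' h h'].
  - by have := DE (FixedElt hb) => /= ->; have := DE' (FixedElt hb) => /= ->.
  - by rewrite DD DD' h h'.
  - by rewrite DM DM' h h'.
split.
- split=> [R R' u g|R g g'|R sR yR]; first exact: orbit_map_nat.
    exact: orbit_map_fibre.
  (* The trivial cover suffices: composing a point of Z_F with [s] lifts it over [R] itself. *)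
  exists R, idfun; split; first exact: fppf_id.
  pose g : {rmorphism H -> R} := hom_map yR \o (s \o gen i H).
  have g_alg b : g (alg_map H b) = alg_map (restr i (Algebra (idfun \o sR))) b.
    rewrite -[LHS]/(yR (s (gen i H (alg_map H b)))) gen_alg s_scal.
    exact: (hom_alg yR).
  pose G : HF i H (Algebra (idfun \o sR)) :=
    @AlgHom k H (restr i (Algebra (idfun \o sR))) g g_alg.
  have y_alg b : hom_map yR (alg_map (ZF r) b) = alg_map (Algebra (idfun \o sR)) b.
    exact: (hom_alg yR).
  pose y' := @AlgHom F (ZF r) (Algebra (idfun \o sR)) (hom_map yR) y_alg.
  exists G; rewrite -[idfun \o yR]/(hom_map y' : _ -> _).
  apply: toF_inj => b; rewrite toF_orbit // toFE.
  rewrite -[inla (FE r) (FE r) b]/(zleft r b) -s_rho.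
  pose x0 : alg_hom (Fk i) (restr i (Algebra (idfun \o sR))) :=
    hom_restr i (hom_str (Algebra (idfun \o sR))).
  (* At [u = rho r b] this is the required equality, since [s] sends [rho r b] to [zleft r b]. *)
  suff h u : copair G x0 u = y' (s u) by exact: h.
  elim/coordF_ind: u => [b'|b'|u v hu hv|u v hu hv].
  - by rewrite [LHS]copair_inra s_scal; exact: (esym (y_alg b')).
  - by rewrite [LHS]copair_inla.
  - by rewrite !rmorphD hu hv.
  - by rewrite !rmorphM hu hv.
- split=> [D|D|v]; [|exact: F_spanP|exact: lie_inertiaP].
  rewrite F_spanP; split=> [[v /funext <-]|hD].
    exact: lieF_vf_kderiv.
  (* The vector fields of the [t j] are dual to the [z j], so this combination takes the same values
     as [D] on them. *)
  exists (\sum_j D (z j) *: t j); apply: der_ext => //.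
    exact: lieF_vf_kderiv.
  move=> m; rewrite lieF_vf_pderF pderF_lie_sum (bigD1 m) //=.
  rewrite -lieF_vf_pderF tz eqxx mulr1 big1 ?addr0 // => l ne.
  by rewrite -lieF_vf_pderF tz (negPf ne) mulr0.
have sum_tz (b : 'I_c -> F) m : \sum_j b j * lieF_vf r (t j) (z m) = b m.
  rewrite (bigD1 m) //= tz eqxx mulr1 big1 ?addr0 // => l ne.
  by rewrite tz (negPf ne) mulr0.
exists c; split.
  (* Modulo inertia, the coordinates of [v] in the family [t] are the values of its vector field at
     the [z j]. *)
  exists t => v; exists (\row_j lieF_vf r v (z j)); split.
    rewrite (lie_inertiaP ha); apply: der_ext => [||m].
    - exact: lieF_vf_kderiv.
    - by split=> *; rewrite ?mulr0 ?mul0r ?addr0.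
    by rewrite lieF_vf_sub sum_tz mxE subrr.
  move=> b; rewrite (lie_inertiaP ha) => hb; apply/rowP => m; rewrite mxE.
  by apply/eqP; rewrite -subr_eq0 -(hb (z m)) lieF_vf_sub sum_tz.
have hpE : p \in [pchar fixed_field r].
  by rewrite -(fmorph_pchar (incl r)); exact: pchar_F i hp.
have zp j : exists e, incl r e = z j ^+ p.
  by exists (FixedElt (fixed_pth_power hp hH r (z j))).
have gen' (L : F -> Prop) : (forall e, L (incl r e)) -> (forall j, L (z j)) ->
    (forall b b', L b -> L b' -> L (b + b')) ->
    (forall b b', L b -> L b' -> L (b * b')) -> forall u, L u.
  by move=> LE; apply: generated => e he; exact: (LE (FixedElt he)).
(* Exponent vectors with entries below [p] index the basis of F over E. *)
pose box := {ffun 'I_c -> 'I_p}.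
have -> : (p ^ c)%N = #|box| by rewrite card_ffun !card_ord.
pose mon (s : box) := monomial z (fun j => s j).
exists (fun l => mon (enum_val l)) => u.
have sumE (b : 'rV[fixed_field r]_#|box|) :
    \sum_l b ord0 l *: (mon (enum_val l) : asmod (FE r)) =
    \sum_s incl r (b 0 (enum_rank s)) * mon s.
  rewrite [RHS](reindex (@enum_val box predT)) /=; last exact/onW_bij/enum_val_bij.
  by apply: eq_bigr => l _; rewrite enum_valK.
have [b bu] := monomials_span hpE zp gen' u.
exists (\row_l b (enum_val l)); split.
  rewrite sumE [LHS]bu; apply: eq_bigr => s' _.
  by rewrite mxE enum_rankK.
move=> b' hb'; apply/rowP => l; rewrite mxE.
apply/eqP; rewrite -subr_eq0; apply/eqP.
have := monomials_free hpE (fun l => lieF_vf_kderiv r (t l)) tz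
  (a := fun s => b s - b' 0 (enum_rank s)).
move=> /(_ _ (enum_val l)); rewrite enum_valK; apply.
under eq_bigr do rewrite rmorphB mulrBl.
by rewrite sumrB -bu -[X in _ - X]sumE -hb' subrr.
Qed.
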